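(* Every connected graph $G$ satisfying $q(G)\ge |G|-1$ belongs to $\mathcal{G}^{\rm SSP}$.
   Context: All graphs are finite, simple, undirected; $|G|$ is the number of vertices of $G$. For a graph $G$ on $\{1,\ldots,n\}$, $\mathcal{S}(G)$ is the set of real symmetric $n\times n$ matrices $A=(a_{ij})$ with $a_{ij}\neq0$ iff $\{i,j\}\in E(G)$ for $i\neq j$ (diagonal arbitrary). For a real symmetric matrix $A$, $q(A)$ is the number of distinct eigenvalues of $A$, and $q(G)=\min\{q(A): A\in\mathcal{S}(G)\}$. A real symmetric $A$ has the strong spectral property (SSP) if the only real symmetric $X$ with $A\circ X=0$, $I\circ X=0$, $AX-XA=0$ is $X=0$ ($\circ$ = entrywise product). $\mathcal{G}^{\rm SSP}$ is the set of graphs $G$ such that every matrix in $\mathcal{S}(G)$ has the SSP. *)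

(* Defs.v *)
From HB Require Import structures.
From mathcomp Require Import all_boot all_order all_algebra.
From mathcomp Require Import finmap boolp classical_sets cardinality reals.
Set Implicit Arguments. Unset Strict Implicit. Unset Printing Implicit Defensive.
Import Order.TTheory GRing.Theory Num.Theory.
Local Open Scope ring_scope.

Definition simple_graph (n : nat) (G : rel 'I_n) : Prop :=
  symmetric G /\ irreflexive G.

Definition connected_graph (n : nat) (G : rel 'I_n) : Prop :=
  forall i j : 'I_n, connect G i j.

Definition in_SG (R : realType) (n : nat) (G : rel 'I_n) (A : 'M[R]_n) : Prop :=
  A^T = A /\ forall i j : 'I_n, i != j -> (A i j != 0) = G i j.

Definition q_mx (R : realType) (n : nat) (A : 'M[R]_n) : nat :=
  size (fset_set (fun a : R => is_true (eigenvalue A a))).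

Definition SSP (R : realType) (n : nat) (A : 'M[R]_n) : Prop :=
  forall X : 'M[R]_n, X^T = X ->
    (forall i j, A i j * X i j = 0) ->
    (forall i, X i i = 0) ->
    A *m X = X *m A -> X = 0.

(* q(G) >= k, i.e. min_{A in S(G)} q(A) >= k (S(G) is nonempty). *)
Definition q_graph_ge (R : realType) (n : nat) (G : rel 'I_n) (k : nat) : Prop :=
  forall A : 'M[R]_n, in_SG G A -> (k <= q_mx A)%N.

Definition in_GSSP (R : realType) (n : nat) (G : rel 'I_n) : Prop :=
  forall A : 'M[R]_n, in_SG G A -> SSP A.

(* Main.v *)
(** A graph with [q(G) >= |G| - 1] has no matrix with two double eigenvalues (or
    one triple eigenvalue).  This forbids many subgraphs.  Suppose a symmetric
    matrix [B] on a subgraph has two double eigenvalues and the entries of [B] on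
    the diagonal and the edges move transversally to the manifold of matrices with
    these eigenvalues.  Extend [B] by a scalar matrix outside the subgraph; then
    small weights can be put on all the remaining edges of [G], and a contraction
    argument corrects [B] so that both double eigenvalues survive.  This rules out
    cycles of length at least 4, two vertices of degree 3 with disjoint pairs of
    further neighbours on a path, three legs of length 2 at a vertex, a triangle
    with three pendant edges, and a triangle with two more edges at a vertex.  A
    vertex of degree 4 is then excluded too: its neighbours lie in different
    components once it is removed, and a singular matrix on each component gives a
    triple eigenvalue.

    Consider now a longest path of [G].  Either it is spanning and has at most one
    chord, which joins vertices at distance 2, or there is exactly one more vertex,
    hanging at an inner vertex of the path.  In each case a symmetric [X] that
    commutes with a matrix of [G] and vanishes on the diagonal and on the edges is
    shown to vanish at distance 2, 3, ... along the path, one entry of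
    [A X - X A] at a time. *)
Require Import Defs.
From HB Require Import structures.
From mathcomp Require Import all_boot all_order all_algebra.
From mathcomp Require Import finmap boolp classical_sets functions cardinality.
From mathcomp Require Import reals interval_inference.
From mathcomp Require Import topology normedtype sequences trigo.
From mathcomp Require Import zify ring lra.
Set Implicit Arguments. Unset Strict Implicit. Unset Printing Implicit Defensive.
Import Order.TTheory GRing.Theory Num.Theory.
Import numFieldNormedType.Exports.
Local Open Scope classical_set_scope.
Local Open Scope ring_scope.

(** * Persistence of multiple eigenvalues *)

(** The eigenvectors are unknowns together with the matrix, while the eigenvalues are prescribed.
    The equation is then quadratic, so Banach's fixed point theorem suffices and no
    differentiability of eigenvalues is involved. What has to be checked on a pattern is dual and
    finite: a linear system in the six entries of two symmetric 2 by 2 matrices, one for each double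
    eigenvalue, must have only the zero solution. Two families of patterns have unbounded size.
    Their weights are chosen so that the eigenvectors are explicit: trigonometric on cycles, affine
    along the inner path of a double broom. The star with four leaves escapes this method. A double
    eigenvalue of a star needs three leaves with that diagonal entry, so four leaves cannot carry
    two of them. Its triple eigenvalue is not stable either: up to scaling, the symmetric matrices
    on the four leaves with zero diagonal and zero row sums form a plane. A vertex of degree four is
    therefore treated by an exact matrix of the whole graph, once cycles and crickets are excluded
    and its branches are separated. *)

Lemma mx_entry_le_norm (R : realType) (m n : nat) (x : 'M[R]_(m, n)) i j :
  `|x i j| <= `|x|.
Proof.
by rewrite [leRHS]/Num.norm /= mx_normrE; apply/bigmax_geP; right => /=; exists (i, j).
Qed.

Lemma linear_mx_bounded (R : realType) (m n p q : nat)
    (f : {linear 'M[R]_(m, n) -> 'M[R]_(p, q)}) :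
  exists2 C, 0 <= C & forall x, `|f x| <= C * `|x|.
Proof.
exists (\sum_i \sum_j `|f (delta_mx i j)|).
  by apply: sumr_ge0 => i _; apply: sumr_ge0.
move=> x; rewrite {1}(matrix_sum_delta x) linear_sum mulr_suml.
apply: le_trans (ler_norm_sum _ _ _) _; apply: ler_sum => i _.
rewrite linear_sum mulr_suml; apply: le_trans (ler_norm_sum _ _ _) _.
apply: ler_sum => j _; rewrite linearZ normrZ mulrC.
by rewrite ler_wpM2l ?mx_entry_le_norm.
Qed.

Lemma bilinear_mx_bounded (R : realType) (m n p q r s : nat)
    (f : 'M[R]_(m, n) -> {linear 'M[R]_(p, q) -> 'M[R]_(r, s)}) :
  (forall y, linear (f^~ y)) ->
  exists2 C, 0 <= C & forall x y, `|f x y| <= C * `|x| * `|y|.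
Proof.
move=> lf.
pose F y : {linear _ -> _} := HB.pack (f^~ y) (GRing.isLinear.Build _ _ _ _ (f^~ y) (lf y)).
have [C Cp] : {C : 'I_m -> 'I_n -> R | forall i j, 0 <= C i j /\
    forall y, `|f (delta_mx i j) y| <= C i j * `|y|}.
  pose B i j := cid2 (linear_mx_bounded (f (delta_mx i j))).
  exists (fun i j => s2val (B i j)) => i j; split; [exact: (s2valP (B i j))|].
  exact: (s2valP' (B i j)).
exists (\sum_i \sum_j C i j).
  by apply: sumr_ge0 => i _; apply: sumr_ge0 => j _; case: (Cp i j).
move=> x y; rewrite -[f x y]/(F y x) {1}(matrix_sum_delta x) linear_sum !mulr_suml.
apply: le_trans (ler_norm_sum _ _ _) _; apply: ler_sum => i _.
rewrite linear_sum !mulr_suml; apply: le_trans (ler_norm_sum _ _ _) _.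
apply: ler_sum => j _; rewrite linearZ normrZ mulrAC mulrC.
case: (Cp i j) => C0 Cb; apply: ler_pM; rewrite ?mx_entry_le_norm //; exact: Cb.
Qed.

(** Banach's theorem asks for a complete normed space, so completeness is joined here to the normed
    structure of matrices. *)
HB.instance Definition _ (R : realType) m n := Complete.on 'M[R]_(m, n).

(** On the ball of radius [r] the quadratic part has Lipschitz constant [2 C r], at most 1/4, and
    [eps] is so small that [eps D + eps |e| / r] is at most 1/4. The right-hand side thus maps the
    ball into itself and contracts by 1/2. *)
Lemma quadratic_fixed_point (R : realType) (m n : nat)
    (Q : 'M[R]_(m, n) -> {linear 'M[R]_(m, n) -> 'M[R]_(m, n)})
    (S : {linear 'M[R]_(m, n) -> 'M[R]_(m, n)}) (e : 'M[R]_(m, n)) (delta : R) :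
  (forall y, linear (Q^~ y)) -> 0 < delta ->
  exists eps g, [/\ 0 < eps, `|g| <= delta & g = Q g g + eps *: (S g + e)].
Proof.
move=> linQ delta0.
have [C C0 Cb] := bilinear_mx_bounded linQ.
have [D D0 Db] := linear_mx_bounded S.
pose r := Num.min delta (1 / (8 * (C + 1))).
have C1 : 0 < C + 1 by lra.
have r0 : 0 < r by rewrite lt_min delta0 /= divr_gt0 ?mulr_gt0.
have Cr : C * r <= 1 / 8.
  have : r <= 1 / (8 * (C + 1)) by rewrite ge_min lexx orbT.
  rewrite ler_pdivlMr ?mulr_gt0 // => h.
  by have -> : C * r = (r * (8 * (C + 1)) - 8 * r) / 8 by [field]; lra.
pose k := D + `|e| / r + 1.
have er : 0 <= `|e| / r by apply: divr_ge0 => //; exact: ltW.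
have k0 : 0 < k by rewrite /k; lra.
pose eps := 1 / (4 * k).
have eps0 : 0 < eps by rewrite divr_gt0 ?mulr_gt0.
have epsk : eps * k = 1 / 4 by rewrite /eps; field; rewrite gt_eqF.
have ee : eps * D + eps * (`|e| / r) <= 1 / 4.
  by rewrite -epsk /k; nra.
have epse : eps * `|e| = eps * (`|e| / r) * r by field; rewrite gt_eqF.
pose phi g := Q g g + eps *: (S g + e).
pose U : set 'M[R]_(m, n) := [set g | `|g| <= r]%classic.
have ler_Q x y a b : `|x| <= a -> `|y| <= b -> `|Q x y| <= C * a * b.
  move=> xa yb; apply: le_trans (Cb x y) _.
  by apply: ler_pM => //; [apply: mulr_ge0 | apply: ler_wpM2l].
have phiU : set_fun U U phi.
  move=> g /= gr; rewrite /U /phi /=.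
  apply: le_trans (ler_normD _ _) _; rewrite normrZ gtr0_norm //.
  have h1 := ler_Q _ _ _ _ gr gr.
  have h2 : `|S g + e| <= D * r + `|e|.
    apply: le_trans (ler_normD _ _) _; apply: lerD => //.
    by apply: le_trans (Db g) _; apply: ler_wpM2l.
  have h3 : eps * `|S g + e| <= eps * (D * r + `|e|) by rewrite ler_wpM2l // ltW.
  have h4 : eps * (D * r + `|e|) = (eps * D + eps * (`|e| / r)) * r.
    by rewrite mulrDr epse; ring.
  have h5 : C * r * r <= 1 / 8 * r by rewrite ler_wpM2r // ltW.
  have h6 : (eps * D + eps * (`|e| / r)) * r <= 1 / 4 * r by rewrite ler_wpM2r // ltW.
  lra.
pose f : {fun U >-> U} := HB.pack phi (@isFun.Build _ _ U U phi phiU).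
have cf : is_contraction f.

  have h0 : 0 <= 1 / 2 :> R by lra.
  exists (NngNum h0); split => /=; first lra.
  move=> [x y] /= [xr yr]; rewrite /f /= /phi.
  have -> : Q x x + eps *: (S x + e) - (Q y y + eps *: (S y + e)) =
      Q (x - y) x + Q y (x - y) + eps *: (S (x - y)).
    have -> : Q (x - y) x = Q x x - Q y x.
      have := linQ x (-1) y x; rewrite !scaleN1r => hh.
      by rewrite addrC hh addrC.
    rewrite (linearB (Q y)) (linearB S) scalerBr subrKA scalerDr scalerDr.
    by rewrite opprD addrACA opprD [X in _ + X]addrACA subrr addr0.
  apply: le_trans (ler_normD _ _) _; rewrite normrZ gtr0_norm //.
  have h1 := ler_Q _ _ _ _ (lexx `|x - y|) xr.
  have h2 := ler_Q _ _ _ _ yr (lexx `|x - y|).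
  have h3 : eps * `|S (x - y)| <= eps * (D * `|x - y|).
    by rewrite ler_wpM2l // ltW.
  have h4 := ler_normD (Q (x - y) x) (Q y (x - y)).
  have h5 : C * r * `|x - y| <= 1 / 8 * `|x - y| by rewrite ler_wpM2r.
  have h6 : eps * D * `|x - y| <= 1 / 4 * `|x - y|.
    by rewrite ler_wpM2r //; apply: le_trans ee; rewrite lerDl mulr_ge0 // ltW.
  move: h1; rewrite mulrAC => h1; rewrite mulrA in h3; lra.
have clU : closed U.
  have -> : U = closed_ball_ Num.norm 0 r.
    by apply/seteqP; split => g; rewrite /U /closed_ball_ /= sub0r normrN.
  exact: closed_closed_ball_.
have [|g gU gfix] := banach_fixed_point cf clU.
  by exists 0; rewrite /U /= normr0 ltW.
by exists eps, g; split => //; apply: (le_trans gU); rewrite ge_min lexx.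
Qed.

Lemma mxtrace_mulTmx (R : realType) (m n : nat) (X Y : 'M[R]_(m, n)) :
  \tr (X^T *m Y) = \sum_i \sum_j X i j * Y i j.
Proof.
rewrite /mxtrace exchange_big /=; apply: eq_bigr => j _.
by rewrite mxE; apply: eq_bigr => i _; rewrite mxE.
Qed.

Lemma mxtrace_sqr_ge0 (R : realType) (m n : nat) (X : 'M[R]_(m, n)) :
  0 <= \tr (X^T *m X).
Proof.
rewrite mxtrace_mulTmx; apply: sumr_ge0 => i _; apply: sumr_ge0 => j _.
by rewrite -expr2 sqr_ge0.
Qed.

Lemma mxtrace_sqr_eq0 (R : realType) (m n : nat) (X : 'M[R]_(m, n)) :
  \tr (X^T *m X) = 0 -> X = 0.
Proof.
rewrite mxtrace_mulTmx => /psumr_eq0P X0; apply/matrixP => i j; rewrite mxE.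
have /psumr_eq0P X0' : \sum_j X i j * X i j = 0.
  by apply: X0 => // a _; apply: sumr_ge0 => b _; rewrite -expr2 sqr_ge0.
have /eqP : X i j * X i j = 0.
  by apply: X0' => // b _; rewrite -expr2 sqr_ge0.
by rewrite mulf_eq0 orbb => /eqP.
Qed.

Lemma injective_lin_mx_unit (R : realType) (m n : nat)
    (f : {linear 'M[R]_(m, n) -> 'M[R]_(m, n)}) :
  (forall x, f x = 0 -> x = 0) -> lin_mx f \in unitmx.
Proof.
move=> f_inj; rewrite -row_free_unit; apply/inj_row_free => v v0.
have := f_inj (vec_mx v); rewrite -[f _]mxvecK -mul_vec_lin vec_mxK v0 linear0.
by move=> /(_ erefl) /(congr1 mxvec); rewrite vec_mxK linear0.
Qed.

(* Dual form of the transversality, at [B], of the symmetric matrices supported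
   on the diagonal and on the support of [B], and those having eigenvalue [lam a]
   with the same multiplicities as in the list [lam]. *)
Definition transversal (R : realType) (n k : nat) (B : 'M[R]_n) (W : 'M[R]_(n, k))
    (lam : 'rV[R]_k) : Prop :=
  forall P : 'M[R]_(n, k), B *m P = P *m diag_mx lam ->
    (forall a b, lam 0 a = lam 0 b -> (W^T *m P) a b = (W^T *m P) b a) ->
    (forall i j, (i == j) || (B i j != 0) -> (P *m W^T + W *m P^T) i j = 0) ->
    P = 0.

(** * Perturbation into S(G) with prescribed eigenvalues *)

Section Perturbation.
Variables (R : realType) (n k : nat) (G : rel 'I_n).
Variables (B : 'M[R]_n) (W : 'M[R]_(n, k)) (lam : 'rV[R]_k).
Hypothesis simpleG : simple_graph G.
Hypothesis symB : B^T = B.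
Hypothesis B_sub : forall i j, i != j -> B i j != 0 -> G i j.
Hypothesis BW : B *m W = W *m diag_mx lam.
Hypothesis trB : transversal B W lam.

Let L := diag_mx lam.

(* The equation [(B + b + eps E) (W + w) = (W + w) (L + M)] is solved with [b], [w]
   and the skew multiplier [M] of the form [bf g], [wf g], [mf g]: these are, up to
   scalars, the components of the adjoint of the linearized map at [g], so the
   linear part [Nf] is a Gram operator, invertible by transversality. *)
Let bf (g : 'M[R]_(n, k)) : 'M[R]_n :=
  \matrix_(i, j) (if (i == j) || (B i j != 0) then (g *m W^T + W *m g^T) i j else 0).
Let wf (g : 'M[R]_(n, k)) : 'M[R]_(n, k) := B *m g - g *m L.
Let mf (g : 'M[R]_(n, k)) : 'M[R]_k :=
  \matrix_(a, b) (if lam 0 a == lam 0 b then (g^T *m W - W^T *m g) a b else 0).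

Let bfE g i j : bf g i j =
  if (i == j) || (B i j != 0) then (g *m W^T + W *m g^T) i j else 0.
Proof. by rewrite mxE. Qed.

Let mfE g a b : mf g a b =
  if lam 0 a == lam 0 b then (g^T *m W - W^T *m g) a b else 0.
Proof. by rewrite mxE. Qed.

Let bf_linear : linear bf.
Proof.
move=> c x y; apply/matrixP => i j.
have e : (c *: x + y) *m W^T + W *m (c *: x + y)^T =
    c *: (x *m W^T + W *m x^T) + (y *m W^T + W *m y^T).
  rewrite linearP /= mulmxDl mulmxDr -scalemxAl -scalemxAr.
  by rewrite scalerDr addrACA.
rewrite bfE e [RHS]mxE [X in _ = X + _]mxE !bfE.
case: ifP => _; last by rewrite mulr0 addr0.
by rewrite [LHS]mxE [X in X + _]mxE.
Qed.

Let wf_linear : linear wf.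
Proof.
move=> c x y; rewrite /wf mulmxDr mulmxDl -scalemxAl -scalemxAr.
by rewrite scalerBr opprD addrACA.
Qed.

Let mf_linear : linear mf.
Proof.
move=> c x y; apply/matrixP => i j.
have e : (c *: x + y)^T *m W - W^T *m (c *: x + y) =
    c *: (x^T *m W - W^T *m x) + (y^T *m W - W^T *m y).
  rewrite linearP /= mulmxDl mulmxDr -scalemxAl -scalemxAr.
  by rewrite opprD addrACA scalerBr.
rewrite mfE e [RHS]mxE [X in _ = X + _]mxE !mfE.
case: ifP => _; last by rewrite mulr0 addr0.
by rewrite [LHS]mxE [X in X + _]mxE.
Qed.

HB.instance Definition _ := GRing.isLinear.Build _ _ _ _ bf bf_linear.
HB.instance Definition _ := GRing.isLinear.Build _ _ _ _ wf wf_linear.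
HB.instance Definition _ := GRing.isLinear.Build _ _ _ _ mf mf_linear.

Let Nf (g : 'M[R]_(n, k)) : 'M[R]_(n, k) :=
  bf g *m W + (B *m wf g - wf g *m L) - W *m mf g.

Let Nf_linear : linear Nf.
Proof.
move=> c x y; rewrite /Nf (linearP bf) (linearP wf) (linearP mf) /=.
move: (bf x) (bf y) (wf x) (wf y) (mf x) (mf y) => b1 b2 w1 w2 m1 m2.
rewrite !mulmxDl !mulmxDr -!scalemxAl -!scalemxAr.
move: (b1 *m W) (B *m w1) (w1 *m L) (W *m m1).
move: (b2 *m W) (B *m w2) (w2 *m L) (W *m m2) => *.
by apply/matrixP => i j; rewrite !mxE; ring.
Qed.

HB.instance Definition _ := GRing.isLinear.Build _ _ _ _ Nf Nf_linear.

Let bf_sym g : (bf g)^T = bf g.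
Proof.
have Bs i j : B i j = B j i by rewrite -{1}symB mxE.
apply/matrixP => i j; rewrite !mxE eq_sym Bs; case: ifP => // _.
by rewrite addrC; congr (_ + _); apply: eq_bigr => a _; rewrite !mxE mulrC.
Qed.

Let mf_skew g : (mf g)^T = - mf g.
Proof.
apply/matrixP => a b; rewrite !mxE eq_sym; case: ifP => _; rewrite ?oppr0 //.
rewrite opprB; congr (_ - _); apply: eq_bigr => i _; by rewrite !mxE mulrC.
Qed.

(** As [bf g] is symmetric, it pairs equally with [g W^T] and with its transpose. The sum of these
    two, masked to the pattern, is [bf g] itself, so each pairing is half of its squared norm. *)
Let tr_bf g : \tr (g^T *m (bf g *m W)) = \tr ((bf g)^T *m bf g) / 2.
Proof.
have e1 : \tr (g^T *m (bf g *m W)) = \tr ((g *m W^T)^T *m bf g).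
  by rewrite trmx_mul trmxK mulmxA mxtrace_mulC mulmxA.
have e2 : \tr ((W *m g^T)^T *m bf g) = \tr ((g *m W^T)^T *m bf g).
  rewrite -[LHS]mxtrace_tr trmx_mul bf_sym trmxK mxtrace_mulC.
  by rewrite trmx_mul trmxK.
have e3 : \tr ((bf g)^T *m bf g) = \tr ((g *m W^T + W *m g^T)^T *m bf g).
  rewrite !mxtrace_mulTmx; apply: eq_bigr => i _; apply: eq_bigr => j _.
  by rewrite !mxE; case: ifP => _; rewrite ?mulr0.
rewrite e3 linearD mulmxDl raddfD /= e2 e1; by field.
Qed.

Let tr_wf g : \tr (g^T *m (B *m wf g - wf g *m L)) = \tr ((wf g)^T *m wf g).
Proof.
have -> : (wf g)^T = g^T *m B - L *m g^T.
  by rewrite /wf linearB /= !trmx_mul symB tr_diag_mx.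
move: (wf g) => w; rewrite mulmxBl mulmxBr !raddfB /= mulmxA; congr (_ - _).
by rewrite mulmxA mxtrace_mulC mulmxA.
Qed.

Let tr_mf g : - \tr (g^T *m (W *m mf g)) = \tr ((mf g)^T *m mf g) / 2.
Proof.
have e1 : \tr (g^T *m (W *m mf g)) = - \tr ((W^T *m g) *m mf g).
  rewrite mulmxA -mxtrace_tr trmx_mul mf_skew trmx_mul trmxK mulNmx raddfN /=.
  by rewrite mxtrace_mulC.
have e2 : \tr ((mf g)^T *m mf g) = \tr ((g^T *m W - W^T *m g)^T *m mf g).
  rewrite !mxtrace_mulTmx; apply: eq_bigr => i _; apply: eq_bigr => j _.
  by rewrite !mxE; case: ifP => _; rewrite ?mulr0.
have e3 : (g^T *m W - W^T *m g)^T = - (g^T *m W - W^T *m g).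
  by rewrite linearB /= !trmx_mul !trmxK opprB.
rewrite e2 e3 mulNmx mulmxBl !raddfN raddfB /= -(mulmxA g^T) e1; by field.
Qed.

(** The pairing of [g] with [Nf g] is [|bf g|^2 / 2 + |wf g|^2 + |mf g|^2 / 2]. If it is zero, the
    vanishing of [wf g], [mf g] and [bf g] gives the three hypotheses of [transversal]. *)
Let Nf_inj g : Nf g = 0 -> g = 0.
Proof.
move=> N0.
have : \tr (g^T *m Nf g) = 0 by rewrite N0 mulmx0 mxtrace0.
rewrite /Nf mulmxBr mulmxDr raddfB raddfD /= tr_bf tr_wf tr_mf.
have := mxtrace_sqr_ge0 (bf g); have := mxtrace_sqr_ge0 (wf g).
have := mxtrace_sqr_ge0 (mf g) => hm hw hb hs.
have /mxtrace_sqr_eq0 b0 : \tr ((bf g)^T *m bf g) = 0 by lra.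
have /mxtrace_sqr_eq0 w0 : \tr ((wf g)^T *m wf g) = 0 by lra.
have /mxtrace_sqr_eq0 m0 : \tr ((mf g)^T *m mf g) = 0 by lra.
apply: trB.
- by apply/eqP; rewrite -subr_eq0 -/L -/(wf g) w0.
- move=> a b lab; have := congr1 (fun X : 'M_k => X a b) m0.
  rewrite !mxE lab eqxx => /eqP; rewrite subr_eq0 => /eqP <-.
  by apply: eq_bigr => i _; rewrite !mxE mulrC.
- move=> i j hij; have := congr1 (fun X : 'M_n => X i j) b0.
  by rewrite /bf mxE hij mxE => ->; rewrite mxE.
Qed.

Let Ni : {linear 'M[R]_(n, k) -> 'M[R]_(n, k)} :=
  vec_mx \o mulmxr (invmx (lin_mx Nf)) \o mxvec.

Let NiK y : Nf (Ni y) = y.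
Proof.
have u := injective_lin_mx_unit Nf_inj.
apply: (can_inj mxvecK).
by rewrite -mul_vec_lin /Ni /= vec_mxK -mulmxA mulVmx // mulmx1.
Qed.

(* The multiplier kills [W1] because [W1^T B1 W1] is symmetric and [mf g] is skew. *)
Let skew_multiplier_vanishes (B1 : 'M[R]_n) (W1 : 'M[R]_(n, k)) g :
  B1^T = B1 -> B1 *m W1 = W1 *m (L + mf g) -> W1 *m mf g = 0.
Proof.
move=> s1 e1; apply: mxtrace_sqr_eq0.
pose S := W1^T *m (W1 *m mf g).
have Ssym a b : lam 0 a = lam 0 b -> S a b = S b a.
  move=> lab.
  have SE : S = W1^T *m B1 *m W1 - (W1^T *m W1) *m L.
    by rewrite -mulmxA e1 mulmxDr mulmxDr mulmxA addrC addKr.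
  have sy (X : 'M[R]_k) c d : X^T = X -> X c d = X d c.
    by move=> sX; rewrite -[in LHS]sX mxE.
  rewrite SE [LHS]mxE [RHS]mxE; congr (_ + _).
    by apply: sy; rewrite !trmx_mul trmxK s1 mulmxA.
  rewrite [LHS]mxE [RHS]mxE /L mul_mx_diag; congr (- _).
  by rewrite [LHS]mxE [RHS]mxE lab sy // trmx_mul trmxK.
rewrite trmx_mul -mulmxA -/S mxtrace_mulTmx.
suff e : \sum_i \sum_j mf g i j * S i j = - (\sum_i \sum_j mf g i j * S i j) by lra.
rewrite {1}exchange_big -sumrN; apply: eq_bigr => a _.
rewrite -sumrN; apply: eq_bigr => b _.
rewrite -mulNr; have -> : - mf g a b = mf g b a.
  by have := congr1 (fun X : 'M_k => X a b) (mf_skew g); rewrite !mxE => ->.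
have [lab|lab] := eqVneq (lam 0 b) (lam 0 a); first by rewrite Ssym.
by rewrite mxE (negbTE lab) !mul0r.
Qed.

(** Independence of the columns of [W1] is claimed only within one eigenvalue, which is enough for
    multiplicities. There it needs no smallness: for [x] supported on one eigenvalue,
    [wf g *m x = B g x - g L x] is orthogonal to the eigenvector [W x], hence [W1 x = 0] forces
    [W x = 0]. *)
Lemma perturb_in_SG : (forall x : 'cV[R]_k, W *m x = 0 -> x = 0) ->
  exists A W1, [/\ in_SG G A, A *m W1 = W1 *m diag_mx lam &
    forall mu (x : 'cV[R]_k), (forall a, lam 0 a != mu -> x a 0 = 0) ->
      W1 *m x = 0 -> x = 0].
Proof.
move=> W_inj.
pose E : 'M[R]_n := \matrix_(i, j) (G i j && (B i j == 0))%:R.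
have Bs i j : B i j = B j i by rewrite -{1}symB mxE.
(* A correction with entries below [c] cannot cancel a nonzero entry of [B]. The default value 1 of
   the minimum keeps [c] positive when [B = 0]. *)
have [c c0 cB] : exists2 c : R, 0 < c & forall i j, B i j != 0 -> c <= `|B i j|.
  exists (\big[Num.min/1]_(p : 'I_n * 'I_n | B p.1 p.2 != 0) `|B p.1 p.2|).
    by apply: lt_bigmin => // p; rewrite normr_gt0.
  by move=> i j Bij; apply: (@bigmin_inf _ _ _ _ (i, j)).
have [C C0 Cb] := linear_mx_bounded bf.
pose delta := c / (2 * (C + 1)).
have C1 : 0 < 2 * (C + 1) by lra.
have d0 : 0 < delta by rewrite divr_gt0.
have dC : C * delta < c.
  have : delta * (2 * (C + 1)) = c by rewrite /delta; field; rewrite gt_eqF //; lra.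
  by move=> <-; rewrite mulrC ltr_pM2l //; lra.
(* Expanding the equation leaves [Nf g = - (b w - w M) - eps (E w + E W)]. Applying the inverse [Ni]
   of [Nf] turns it into a fixed point equation with quadratic part [Q0], linear part [S0] and
   constant [- Ni (E W)]. *)
pose Q0 x y := - Ni (bf x *m wf y - wf y *m mf x).
have linQ0 x : linear (Q0 x).
  move=> a y z; rewrite /Q0 (linearP wf).
  have -> : bf x *m (a *: wf y + wf z) - (a *: wf y + wf z) *m mf x =
      a *: (bf x *m wf y - wf y *m mf x) + (bf x *m wf z - wf z *m mf x).
    move: (wf y) (wf z) (bf x) (mf x) => w1 w2 b m0.
    by rewrite mulmxDr mulmxDl -scalemxAl -scalemxAr scalerBr opprD addrACA.
  by rewrite (linearP Ni) opprD scalerN.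
pose Q x : {linear _ -> _} := HB.pack (Q0 x) (GRing.isLinear.Build _ _ _ _ (Q0 x) (linQ0 x)).
pose S0 x := - Ni (E *m wf x).
have linS0 : linear S0.
  move=> a y z; rewrite /S0 (linearP wf).
  have -> : E *m (a *: wf y + wf z) = a *: (E *m wf y) + E *m wf z.
    by move: (wf y) (wf z) => w1 w2; rewrite mulmxDr -scalemxAr.
  by rewrite (linearP Ni) opprD scalerN.
pose S : {linear _ -> _} := HB.pack S0 (GRing.isLinear.Build _ _ _ _ S0 linS0).
have linQl y : linear (Q^~ y).
  move=> a x z; rewrite /Q /= /Q0 (linearP bf) (linearP mf).
  have -> : (a *: bf x + bf z) *m wf y - wf y *m (a *: mf x + mf z) =
      a *: (bf x *m wf y - wf y *m mf x) + (bf z *m wf y - wf y *m mf z).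
    move: (wf y) (bf x) (mf x) (bf z) (mf z) => w b1 m1 b2 m2.
    by rewrite mulmxDr mulmxDl -scalemxAl -scalemxAr scalerBr opprD addrACA.
  by rewrite (linearP Ni) opprD scalerN.
have [eps [g [eps0 gd gfix]]] := quadratic_fixed_point S (- Ni (E *m W)) linQl d0.
pose A := B + bf g + eps *: E; pose W1 := W + wf g.
have symA : A^T = A.
  rewrite /A !linearD linearZ /= symB bf_sym; congr (_ + _ *: _).
  by apply/matrixP => i j; rewrite !mxE Bs (proj1 simpleG).
have AW1 : A *m W1 = W1 *m (L + mf g).
  have : Nf g = - (bf g *m wf g - wf g *m mf g) - eps *: (E *m wf g + E *m W).
    have NiE a b c1 : Nf (- Ni a + eps *: (- Ni b - Ni c1)) = - a - eps *: (b + c1).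
      have NfN x : Nf (- Ni x) = - x by rewrite -[in RHS](NiK x); exact: (linearN Nf).
      transitivity (eps *: Nf (- Ni b - Ni c1) + Nf (- Ni a)).
        by rewrite addrC; exact: (linearP Nf).
      have -> : Nf (- Ni b - Ni c1) = Nf (- Ni b) + Nf (- Ni c1) by exact: (linearD Nf).
      by rewrite !NfN -opprD scalerN addrC.
    by rewrite {1}gfix; exact: NiE.
  rewrite /Nf => /eqP; rewrite -subr_eq0 => /eqP e.
  apply/eqP; rewrite -subr_eq0; apply/eqP; rewrite -[RHS]e {e}.
  rewrite /A /W1; move: (wf g) (bf g) (mf g) => w b m0.
  rewrite !mulmxDl !mulmxDr BW -/L -!scalemxAl.
  move: (W *m L) (W *m m0) (w *m L) (w *m m0) (B *m w).
  move: (b *m W) (b *m w) (E *m W) (E *m w) => *.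
  by apply/matrixP => i j; rewrite !mxE; ring.
have WM := skew_multiplier_vanishes symA AW1.
exists A, W1; split.
- split=> // i j ij.
  have -> : A i j = B i j + bf g i j + eps * (G i j && (B i j == 0))%:R.
    by rewrite !mxE.
  have [Bij|Bij] := eqVneq (B i j) 0.
    rewrite bfE (negbTE ij) Bij eqxx !add0r andbT.
    by case: (G i j); rewrite ?mulr1 ?mulr0 ?eqxx // gt_eqF.
  rewrite andbF mulr0 addr0 (B_sub ij Bij).
  have h : `|bf g i j| < c.
    apply: le_lt_trans (mx_entry_le_norm _ i j) _; apply: le_lt_trans (Cb g) _.
    by apply: le_lt_trans dC; rewrite ler_wpM2l.
  apply/negP; rewrite addr_eq0 => /eqP Bb; have := cB _ _ Bij.
  by rewrite Bb normrN leNgt h.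
- by rewrite AW1 mulmxDr WM addr0.
- move=> mu x xmu W1x; apply: W_inj; apply: mxtrace_sqr_eq0.
  have Lx : L *m x = mu *: x.
    apply/matrixP => a b; rewrite /L mul_diag_mx !mxE [b]ord1.
    by have [->//|/xmu ->] := eqVneq (lam 0 a) mu; rewrite !mulr0.
  have xL : x^T *m L = mu *: x^T.
    by apply: trmx_inj; rewrite trmx_mul trmxK tr_diag_mx Lx linearZ /= trmxK.
  have : x^T *m W^T *m (W1 *m x) = 0 by rewrite W1x mulmx0.
  have WB : W^T *m B = L *m W^T.
    by apply: trmx_inj; rewrite !trmx_mul trmxK symB tr_diag_mx.
  rewrite /W1 /wf mulmxDl mulmxBl mulmxDr mulmxBr.
  rewrite -[(x^T *m W^T) *m (_ *m L *m x)]mulmxA -[g *m L *m x]mulmxA Lx.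
  rewrite -[x^T *m W^T *m (B *m g *m x)]mulmxA -[B *m g *m x]mulmxA.
  rewrite (mulmxA W^T B) WB -!mulmxA (mulmxA x^T L) xL -!scalemxAl -!scalemxAr subrr addr0.
  by rewrite trmx_mul => e; rewrite -!mulmxA e mxtrace0.
Qed.
End Perturbation.

(** The bound [(x == y).+1] treats two cases at once: two eigenvalues of multiplicity at least two,
    or, when [x = y], one of multiplicity at least three. Eigenspaces are independent, so their
    dimensions add up to at most [n], and this sum exceeds the number of eigenvalues by at least
    2. *)
Lemma q_mx_le_rank (R : realType) (n : nat) (A : 'M[R]_n) (x y : R) :
  ((x == y).+1 < \rank (eigenspace A x))%N ->
  ((x == y).+1 < \rank (eigenspace A y))%N ->
  (q_mx A + 2 <= n)%N.
Proof.
move=> rx ry; have ex : eigenvalue A x by rewrite /eigenvalue -mxrank_eq0 -lt0n; lia.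
have ey : eigenvalue A y by rewrite /eigenvalue -mxrank_eq0 -lt0n; lia.
have rn := rank_leq_col (eigenspace A x).
rewrite /q_mx; set E := fun a => _.
(* [fset_set] is empty by default on an infinite set, so that case only needs [2 <= n], which the
   rank hypotheses give. *)
have [finE|infE] := pselect (finite_set E); last first.
  suff -> : fset_set E = fset0 by rewrite cardfs0; lia.
  by rewrite /fset_set; case: pselect.
set s := fset_set E.
have us : uniq s by exact: fset_uniq.
have sE a : (a \in s) = eigenvalue A a.
  by rewrite /s in_fset_set //; apply/idP/idP; rewrite inE.
rewrite -[size _]/(size (s : seq R)).
have dx : mxdirect (\sum_(i < size s) eigenspace A (tnth (in_tuple s) i)).
  apply: mxdirect_sum_eigenspace => i j _ _ eij; apply: val_inj => /=.
  move: eij; rewrite !(tnth_nth 0) /= => /eqP.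
  by rewrite nth_uniq ?ltn_ord // => /eqP.
have le1 : (\sum_(i < size s) \rank (eigenspace A (tnth (in_tuple s) i)) <= n)%N.
  by rewrite -(mxdirectP dx) rank_leq_col.
have eqsum (F : R -> nat) :
    (\sum_(i < size s) F (tnth (in_tuple s) i) = \sum_(a <- s) F a)%N.
  by rewrite [RHS]big_tnth.
rewrite (eqsum (fun a => \rank (eigenspace A a))) in le1.
have le2 : (\sum_(a <- s) (1 + ((a == x) + (a == y))) <=
    \sum_(a <- s) \rank (eigenspace A a))%N.
  rewrite big_seq [leqRHS]big_seq; apply: leq_sum => a; rewrite sE => ea.
  have : (0 < \rank (eigenspace A a))%N by rewrite lt0n mxrank_eq0.
  have [->|ax] := eqVneq a x; first by move: rx; case: eqP; lia.
  by have [->|ay] := eqVneq a y; first by move: ry; case: eqP; lia.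
have count1 z : eigenvalue A z -> (\sum_(a <- s) (a == z) = 1)%N.
  move=> ez; rewrite -big_mkcond /= sum1_count.
  by have := count_uniq_mem z us; rewrite sE ez.
apply: leq_trans le1; apply: leq_trans le2.
by rewrite !big_split /= !count1 // sum1_size.
Qed.

(** Rows of [eigenspace] are left eigenvectors, whence the transpose and the symmetry of [A]. Only
    the columns selected by [f] have to be independent, which is what [perturb_in_SG] supplies. *)
Lemma rank_eigenspace_ge (R : realType) (n k r : nat) (A : 'M[R]_n)
    (W : 'M[R]_(n, k)) (mu : R) (f : 'I_r -> 'I_k) :
  A^T = A -> injective f ->
  (forall a, A *m col (f a) W = mu *: col (f a) W) ->
  (forall x : 'cV[R]_k, (forall c, c \notin codom f -> x c 0 = 0) ->
     W *m x = 0 -> x = 0) ->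
  (r <= \rank (eigenspace A mu))%N.
Proof.
move=> symA f_inj eigW W_inj.
pose M := (colsub f W)^T.
have eigM : (M <= eigenspace A mu)%MS.
  apply/eigenspaceP; apply: trmx_inj; rewrite trmx_mul symA linearZ /= trmxK.
  apply/matrixP => i a; have := congr1 (fun X : 'cV_n => X i 0) (eigW a).
  rewrite !mxE => <-; apply: eq_bigr => j _; by rewrite !mxE.
have freeM : row_free M.
  apply/inj_row_free => v vM.
  pose x : 'cV[R]_k := \col_c \sum_(a | f a == c) v 0 a.
  have xf a : x (f a) 0 = v 0 a.
    rewrite mxE (eq_bigl (pred1 a)) ?big_pred1_eq // => b.
    by rewrite (inj_eq f_inj).
  have x0 : x = 0.
    apply: W_inj => [c cf|].
      rewrite mxE big1 // => a /eqP fac.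
      by move: cf; rewrite -fac codom_f.
    apply/matrixP => i j; rewrite [j]ord1 !mxE.
    have := congr1 (fun X : 'rV_n => X 0 i) vM; rewrite !mxE => h; rewrite -[RHS]h.
    under eq_bigr => c _ do rewrite mxE mulr_sumr.
    rewrite (exchange_big_dep xpredT) //=; apply: eq_bigr => a _.
    by rewrite (big_pred1 (f a)) => [|c]; [rewrite !mxE mulrC | rewrite /= eq_sym].
  by apply/matrixP => i j; rewrite [i]ord1 -xf x0 !mxE.
by rewrite -(eqP freeM); exact: mxrankS.
Qed.

(** * Extension of a pattern to all vertices by a scalar matrix *)

Section Embedding.
Variables (R : realType) (n h k : nat) (f : 'I_h -> 'I_n).
Variables (B : 'M[R]_h) (W : 'M[R]_(h, k)) (lam : 'rV[R]_k) (d : R).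
Hypothesis f_inj : injective f.

Let F : 'M[R]_(h, n) := \matrix_(a, i) (f a == i)%:R.

(** [F^T *m F] is the projection onto the coordinates in the image of [f], so this is the direct sum
    of [B] there and of [d] times the identity on the other coordinates. *)
Definition embed_mx : 'M[R]_n := F^T *m B *m F + d *: (1%:M - F^T *m F).
Definition embed_cols : 'M[R]_(n, k) := F^T *m W.

Let FFT : F *m F^T = 1%:M.
Proof.
apply/matrixP => a b; rewrite !mxE (bigD1 (f a)) //= !mxE eqxx mul1r big1.
  by rewrite addr0 (inj_eq f_inj) eq_sym.
by move=> i ia; rewrite !mxE eq_sym (negbTE ia) mul0r.
Qed.

Let FD : F *m (1%:M - F^T *m F) = 0.
Proof. by rewrite mulmxBr mulmx1 mulmxA FFT mul1mx subrr. Qed.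

Let DF : (1%:M - F^T *m F) *m F^T = 0.
Proof. by rewrite mulmxBl mul1mx -mulmxA FFT mulmx1 subrr. Qed.

Let conjF (p : nat) (X : 'M[R]_(h, p)) a j : (F^T *m X) (f a) j = X a j.
Proof.
rewrite mxE (bigD1 a) //= !mxE eqxx mul1r big1 ?addr0 // => b ba.
by rewrite !mxE (inj_eq f_inj) (negbTE ba) mul0r.
Qed.

Let conjF0 (p : nat) (X : 'M[R]_(h, p)) i j : i \notin codom f -> (F^T *m X) i j = 0.
Proof.
move=> fi; rewrite mxE big1 // => b _; rewrite !mxE.
by case: eqP => [fb|]; rewrite ?mul0r //; move: fi; rewrite -fb codom_f.
Qed.

Let FXF (X : 'M[R]_h) a b : (F^T *m X *m F) (f a) (f b) = X a b.
Proof.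
rewrite -mulmxA conjF mxE (bigD1 b) //= !mxE eqxx mulr1 big1 ?addr0 // => c cb.
by rewrite !mxE (inj_eq f_inj) (negbTE cb) mulr0.
Qed.

Let FXF0 (X : 'M[R]_h) i j : (F^T *m X *m F) i j != 0 ->
  exists a b, [/\ i = f a, j = f b & X a b != 0].
Proof.
move=> nz.
have [/codomP[a ia]|ni] := boolP (i \in codom f); last first.
  by rewrite -mulmxA conjF0 ?eqxx in nz.
have [/codomP[b jb]|nj] := boolP (j \in codom f); last first.
  move: nz; rewrite -[_ *m F]trmxK mxE trmx_mul conjF0 ?eqxx //.
by exists a, b; split => //; rewrite -FXF -ia -jb.
Qed.

Let restrF (X : 'M[R]_n) a b : (F *m X *m F^T) a b = X (f a) (f b).
Proof.
have FX (p : nat) (Z : 'M[R]_(n, p)) c j : (F *m Z) c j = Z (f c) j.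
  rewrite mxE (bigD1 (f c)) //= mxE eqxx mul1r big1 ?addr0 // => i ic.
  by rewrite mxE eq_sym (negbTE ic) mul0r.
by rewrite -[_ *m F^T]trmxK mxE trmx_mul trmxK FX mxE FX.
Qed.

Let embedE i j :
  embed_mx i j = (F^T *m B *m F) i j + d * ((i == j)%:R - (F^T *m F) i j).
Proof. by rewrite !mxE. Qed.

Lemma embed_mx_offdiag i j : i != j -> embed_mx i j != 0 ->
  exists a b, [/\ i = f a, j = f b & B a b != 0].
Proof.
move=> ij nz; apply: FXF0.
suff e : embed_mx i j = (F^T *m B *m F) i j by rewrite -e.
suff e1 : (F^T *m F) i j = 0.
  by rewrite embedE e1 (negbTE ij) subrr mulr0 addr0.
apply/eqP/negPn/negP; rewrite -[F^T]mulmx1 => /FXF0[a [b [ia jb]]].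
by rewrite mxE; case: (eqVneq a b) => [ab|_]; rewrite ?eqxx //; rewrite ia jb ab eqxx in ij.
Qed.

Lemma embed_mx_edge a b : a != b -> embed_mx (f a) (f b) = B a b.
Proof.
move=> ab; rewrite embedE FXF -[F^T in X in _ - X]mulmx1 FXF mxE (inj_eq f_inj).
by rewrite (negbTE ab) subrr mulr0 addr0.
Qed.

Lemma embed_mx_sym : B^T = B -> embed_mx^T = embed_mx.
Proof.
move=> sB; rewrite /embed_mx linearD linearZ /= linearB /= trmx1.
by rewrite !trmx_mul trmxK sB mulmxA.
Qed.

Lemma embed_eigen : B *m W = W *m diag_mx lam ->
  embed_mx *m embed_cols = embed_cols *m diag_mx lam.
Proof.
move=> BW; rewrite /embed_mx /embed_cols mulmxDl -scalemxAl.
rewrite [X in _ *: X]mulmxA DF mul0mx scaler0 addr0.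
by rewrite -!mulmxA [F *m _]mulmxA FFT mul1mx BW.
Qed.

Lemma embed_cols_inj : (forall x : 'cV[R]_k, W *m x = 0 -> x = 0) ->
  forall x : 'cV[R]_k, embed_cols *m x = 0 -> x = 0.
Proof.
move=> W_inj x Wx; apply: W_inj.
by rewrite -[LHS]mul1mx -FFT -mulmxA [F^T *m _]mulmxA Wx mulmx0.
Qed.

(* Outside the image of [f] the matrix is [d] times the identity, and [d] is none
   of the prescribed eigenvalues, so all eigenvectors live on the image. *)
Lemma embed_transversal : (forall a, lam 0 a != d) ->
  transversal B W lam -> transversal embed_mx embed_cols lam.
Proof.
move=> lamd trB P BP symP patP.
have DP : (1%:M - F^T *m F) *m P = 0.
  have : (1%:M - F^T *m F) *m (embed_mx *m P) = d *: ((1%:M - F^T *m F) *m P).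
    rewrite /embed_mx mulmxA mulmxDr -!mulmxA [_ *m (F^T *m _)]mulmxA DF mul0mx add0r.
    rewrite -scalemxAr -scalemxAl; congr (_ *: (_ *m _)).
    by rewrite mulmxBr mulmx1 mulmxA DF mul0mx subr0.
  rewrite BP mulmxA; move: (_ *m P) => D0 e.
  apply/matrixP => i a; rewrite mxE; apply/eqP.
  have := congr1 (fun X : 'M_(n, k) => X i a) e.
  rewrite mul_mx_diag !mxE mulrC => /eqP; rewrite -subr_eq0 -mulrBl mulf_eq0 => /orP[|//].
  by rewrite subr_eq0 (negbTE (lamd a)).
have PE : P = F^T *m (F *m P).
  by apply/eqP; rewrite -subr_eq0 mulmxA -{1}[P]mul1mx -mulmxBl DP.
rewrite PE (trB (F *m P)) ?mulmx0 //.
- have : F *m (embed_mx *m P) = F *m P *m diag_mx lam by rewrite BP mulmxA.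
  rewrite /embed_mx mulmxDl mulmxDr -scalemxAl -scalemxAr [F *m (_ *m P)]mulmxA.
  by rewrite [X in _ *: X]mulmxA FD mul0mx scaler0 addr0 !mulmxA FFT mul1mx.
- move=> a b /symP; rewrite /embed_cols trmx_mul trmxK !mulmxA.
  by rewrite -!(mulmxA W^T).
- move=> a b ab.
  have -> : (F *m P) *m W^T + W *m (F *m P)^T = F *m (P *m embed_cols^T + embed_cols *m P^T) *m F^T.
    rewrite /embed_cols !trmx_mul trmxK mulmxDr mulmxDl !mulmxA FFT mul1mx.
    by rewrite -(mulmxA (F *m P *m W^T)) FFT mulmx1.
  set Y := P *m _ + _.
  have Yab : Y (f a) (f b) = 0.
    apply: patP; rewrite (inj_eq f_inj); case: eqVneq ab => //= neab.
    by rewrite embed_mx_edge.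
  by rewrite restrF.
Qed.
End Embedding.

(** * Forbidden subgraphs *)

(** Entries are indexed by [nat] and cut at [h], so that index arithmetic is left to [lia] and
    explicit tables compute. *)
Definition is_eigvec (R : realType) (h : nat) (b : nat -> nat -> R) (a : R)
    (p : nat -> R) : Prop :=
  forall i, (i < h)%N -> \sum_(j < h) b i j * p j = a * p i.

Definition eigenspace_basis (R : realType) (h : nat) (b : nat -> nat -> R) (a : R)
    (u1 u2 : nat -> R) : Prop :=
  [/\ is_eigvec h b a u1, is_eigvec h b a u2 &
    forall p, is_eigvec h b a p ->
      exists c1 c2, forall i, (i < h)%N -> p i = c1 * u1 i + c2 * u2 i].

(** Entry [(i, j)] of [U Y U^T], where [U] has the columns [u1], [u2] and [Y] has the rows
    [(y1, y2)] and [(y2, y3)]. *)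
Definition quad_entry (R : realType) (u1 u2 : nat -> R) (y1 y2 y3 : R) (i j : nat) : R :=
  y1 * (u1 i * u1 j) + y2 * (u1 i * u2 j + u2 i * u1 j) + y3 * (u2 i * u2 j).

(* [b] has two double eigenvalues, and a matrix [U Y U^T + V Z V^T] built on the
   two eigenspaces is zero as soon as it vanishes on the diagonal and on the
   edges of [b]; this makes the double eigenvalues persist in supergraphs. *)
Definition two_stable_double_eigenvalues (R : realType) (h : nat)
    (b : nat -> nat -> R) : Prop :=
  exists a1 a2 u1 u2 v1 v2,
  [/\ a1 != a2, eigenspace_basis h b a1 u1 u2, eigenspace_basis h b a2 v1 v2 &
    forall y1 y2 y3 z1 z2 z3,
      (forall i j, (i < h)%N -> (j < h)%N -> (i == j) || (b i j != 0) ->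
         quad_entry u1 u2 y1 y2 y3 i j + quad_entry v1 v2 z1 z2 z3 i j = 0) ->
      [/\ y1 = 0, y2 = 0 & y3 = 0] /\ [/\ z1 = 0, z2 = 0 & z3 = 0]].

Section Forbidden.
Variables (R : realType) (n : nat) (G : rel 'I_n).
Hypothesis simpleG : simple_graph G.
Hypothesis qG : q_graph_ge R G n.-1.

Lemma no_two_defects (A : 'M[R]_n) (x y : R) : in_SG G A ->
  ((x == y).+1 < \rank (eigenspace A x))%N ->
  ((x == y).+1 < \rank (eigenspace A y))%N -> False.
Proof.
by move=> /qG qA rx ry; have := q_mx_le_rank rx ry; move: qA; lia.
Qed.

(** The diagonal and edge conditions see only the symmetric part of the coefficients of [P] in an
    eigenspace. The skew part is killed by the symmetry of [W^T P], because the two off-diagonal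
    entries compared here differ by [c (|u1|^2 + |u2|^2)]. *)
Lemma skew_combination_eq0 (h : nat) (u1 u2 p1 p2 : nat -> R) (c : R) :
  (forall i, (i < h)%N -> p1 i = c * u2 i) ->
  (forall i, (i < h)%N -> p2 i = - c * u1 i) ->
  \sum_(i < h) u1 i * p2 i = \sum_(i < h) u2 i * p1 i ->
  c = 0 \/ forall i, (i < h)%N -> u1 i = 0.
Proof.
move=> e1 e2 s.
have : c * \sum_(i < h) (u1 i ^+ 2 + u2 i ^+ 2) = 0.
  have -> : c * \sum_(i < h) (u1 i ^+ 2 + u2 i ^+ 2) =
      \sum_(i < h) (u2 i * p1 i - u1 i * p2 i).
    rewrite mulr_sumr; apply: eq_bigr => i _; rewrite e1 // e2 //; ring.
  by rewrite sumrB s subrr.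
move=> /eqP; rewrite mulf_eq0 => /orP[/eqP|/eqP /psumr_eq0P u0]; [by left | right].
move=> i ih; have /eqP : u1 i ^+ 2 + u2 i ^+ 2 = 0.
  by apply: (u0 _ (Ordinal ih)) => // j _; rewrite addr_ge0 ?sqr_ge0.
by rewrite paddr_eq0 ?sqr_ge0 // sqrf_eq0 => /andP[/eqP].
Qed.

Lemma forbidden_subgraph (h : nat) (b : nat -> nat -> R) (s : seq 'I_n) (x0 : 'I_n) :
  uniq s -> size s = h -> (forall i j, (i < h)%N -> (j < h)%N -> b i j = b j i) ->
  two_stable_double_eigenvalues h b ->
  (forall i j, (i < h)%N -> (j < h)%N -> i != j -> b i j != 0 ->
     G (nth x0 s i) (nth x0 s j)) ->
  False.
Proof.
move=> us sh bsym [a1 [a2 [u1 [u2 [v1 [v2 [a12 [eu1 eu2 spanu] [ev1 ev2 spanv] quad]]]]]]] bG.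
pose f (i : 'I_h) := nth x0 s i.
have f_inj : injective f.
  move=> i j /eqP; rewrite /f nth_uniq ?sh ?ltn_ord // => /eqP; exact: val_inj.
pose B : 'M[R]_h := \matrix_(i, j) b i j.
pose cs (a : 'I_4) : nat -> R := nth u1 [:: u1; u2; v1; v2] a.
pose W : 'M[R]_(h, 4) := \matrix_(i, a) cs a i.
pose lam : 'rV[R]_4 := \row_a (if (a < 2)%N then a1 else a2).
have symB : B^T = B by apply/matrixP => i j; rewrite !mxE bsym.
have BW : B *m W = W *m diag_mx lam.
  apply/matrixP => i a; rewrite mul_mx_diag !mxE mulrC.
  under eq_bigr => j _ do rewrite !mxE.
  by case: a => [] [|[|[|[|//]]]] ha /=; [exact: eu1|exact: eu2|exact: ev1|exact: ev2].
pose o0 : 'I_4 := @Ordinal 4 0 isT; pose o1 : 'I_4 := @Ordinal 4 1 isT.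
pose o2 : 'I_4 := @Ordinal 4 2 isT; pose o3 : 'I_4 := @Ordinal 4 3 isT.
have sum4 (F : 'I_4 -> R) : \sum_a F a = F o0 + F o1 + F o2 + F o3.
  rewrite !big_ord_recl big_ord0 addr0 !addrA.
  by congr (F _ + F _ + F _ + F _); apply: val_inj.
have WE (x : 'cV[R]_4) (i : 'I_h) : (W *m x) i 0 =
    u1 i * x o0 0 + u2 i * x o1 0 + v1 i * x o2 0 + v2 i * x o3 0.
  by rewrite mxE sum4 !mxE.
have W_inj (x : 'cV[R]_4) : W *m x = 0 -> x = 0.
  move=> Wx.
  have Lx : W *m (diag_mx lam *m x) = 0 by rewrite mulmxA -BW -mulmxA Wx mulmx0.
  pose s1 i := x o0 0 * u1 i + x o1 0 * u2 i.
  pose s2 i := x o2 0 * v1 i + x o3 0 * v2 i.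
  have s12 i : (i < h)%N -> s1 i = 0 /\ s2 i = 0.
    move=> ih; have := congr1 (fun X : 'cV_h => X (Ordinal ih) 0) Wx.
    have := congr1 (fun X : 'cV_h => X (Ordinal ih) 0) Lx.
    rewrite !WE /= mul_diag_mx !mxE /= => e1 e2.
    have e3 : s1 i + s2 i = 0 by rewrite -[RHS]e2 /s1 /s2; ring.
    have e4 : a1 * s1 i + a2 * s2 i = 0 by rewrite -[RHS]e1 /s1 /s2; ring.
    have : (a1 - a2) * s1 i = 0.
      by rewrite -[RHS]e4; move/eqP: e3; rewrite addrC addr_eq0 => /eqP ->; ring.
    move=> /eqP; rewrite mulf_eq0 subr_eq0 (negbTE a12) => /eqP s10.
    by split=> //; rewrite -[RHS]e3 s10 add0r.
  (* With the rank one choice [Y = x x^T] in each eigenspace the matrices are the squares of [s1]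
     and [s2], which vanish, so stability forces [x = 0]. *)
  have [|[x0_0 _ x1_0] [x2_0 _ x3_0]] := quad (x o0 0 ^+ 2) (x o0 0 * x o1 0) (x o1 0 ^+ 2)
      (x o2 0 ^+ 2) (x o2 0 * x o3 0) (x o3 0 ^+ 2).
    move=> i j ih jh _; transitivity (s1 i * s1 j + s2 i * s2 j).
      by rewrite /quad_entry /s1 /s2; ring.
    by have [-> ->] := s12 i ih; rewrite !mul0r addr0.
  have xo (o : 'I_4) : x o 0 ^+ 2 = 0 -> x o 0 = 0 by move/eqP; rewrite sqrf_eq0 => /eqP.
  apply/matrixP => a z; rewrite [z]ord1 mxE; case: a => [] [|[|[|[|//]]]] ha.
  - by rewrite -(xo o0) //; congr (x _ _); apply: val_inj.
  - by rewrite -(xo o1) //; congr (x _ _); apply: val_inj.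
  - by rewrite -(xo o2) //; congr (x _ _); apply: val_inj.
  - by rewrite -(xo o3) //; congr (x _ _); apply: val_inj.
have nz_u1 : ~ forall i, (i < h)%N -> u1 i = 0.
  move=> u10; have [|[+ _ _] _] := quad 1 0 0 0 0 0; last by move/eqP; rewrite oner_eq0.
  by move=> i j ih jh _; rewrite /quad_entry u10 //; ring.
have nz_v1 : ~ forall i, (i < h)%N -> v1 i = 0.
  move=> v10; have [|_ [+ _ _]] := quad 0 0 0 1 0 0; last by move/eqP; rewrite oner_eq0.
  by move=> i j ih jh _; rewrite /quad_entry v10 //; ring.
have trB : transversal B W lam.
  move=> P BP symP patP.
  pose p (a : 'I_4) (i : nat) : R := if insub i is Some i' then P i' a else 0.
  have pE a (i : 'I_h) : p a i = P i a by rewrite /p valK.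
  have eigp a : is_eigvec h b (lam 0 a) (p a).
    move=> i ih; have := congr1 (fun X : 'M_(h, 4) => X (Ordinal ih) a) BP.
    rewrite mul_mx_diag !mxE -pE /= mulrC => <-.
    by apply: eq_bigr => j _; rewrite mxE pE.
  have [c1 [c2 e0]] : exists c1 c2, forall i, (i < h)%N -> p o0 i = c1 * u1 i + c2 * u2 i.
    by apply: spanu; have := eigp o0; rewrite mxE.
  have [c3 [c4 e1]] : exists c1 c2, forall i, (i < h)%N -> p o1 i = c1 * u1 i + c2 * u2 i.
    by apply: spanu; have := eigp o1; rewrite mxE.
  have [d1 [d2 e2]] : exists c1 c2, forall i, (i < h)%N -> p o2 i = c1 * v1 i + c2 * v2 i.
    by apply: spanv; have := eigp o2; rewrite mxE.
  have [d3 [d4 e3]] : exists c1 c2, forall i, (i < h)%N -> p o3 i = c1 * v1 i + c2 * v2 i.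
    by apply: spanv; have := eigp o3; rewrite mxE.
  (* If [C] is the coefficient matrix of [P] in an eigenspace, then [P W^T + W P^T] has the
     coefficient matrix [C + C^T] up to transposition, with entries [2 c1], [c2 + c3], [2 c4]. *)
  have [|[c10 c23 c40] [d10 d23 d40]] := quad (c1 *+ 2) (c2 + c3) (c4 *+ 2)
      (d1 *+ 2) (d2 + d3) (d4 *+ 2).
    move=> i j ih jh ij; have := patP (Ordinal ih) (Ordinal jh).
    rewrite !mxE /= -val_eqE /= => /(_ ij).
    rewrite -big_split /= sum4 !mxE /= -!pE /= !e0 // !e1 // !e2 // !e3 // => e.
    by rewrite -[RHS]e /quad_entry /cs /=; ring.
  have {}c10 : c1 = 0 by lra.
  have {}c40 : c4 = 0 by lra.
  have {}d10 : d1 = 0 by lra.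
  have {}d40 : d4 = 0 by lra.
  have {}c23 : c3 = - c2 by lra.
  have {}d23 : d3 = - d2 by lra.
  have c20 : c2 = 0.
    have [|||//|/nz_u1//] := @skew_combination_eq0 h u1 u2 (p o0) (p o1) c2.
    - by move=> i ih; rewrite e0 // c10; ring.
    - by move=> i ih; rewrite e1 // c40 c23; ring.
    - have := symP o0 o1; rewrite !mxE /= => /(_ erefl) e.
      transitivity (\sum_(j < h) W^T o0 j * P j o1).
        by apply: eq_bigr => i _; rewrite !mxE pE.
      by rewrite e; apply: eq_bigr => i _; rewrite !mxE pE.
  have d20 : d2 = 0.
    have [|||//|/nz_v1//] := @skew_combination_eq0 h v1 v2 (p o2) (p o3) d2.
    - by move=> i ih; rewrite e2 // d10; ring.
    - by move=> i ih; rewrite e3 // d40 d23; ring.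
    - have := symP o2 o3; rewrite !mxE /= => /(_ erefl) e.
      transitivity (\sum_(j < h) W^T o2 j * P j o3).
        by apply: eq_bigr => i _; rewrite !mxE pE.
      by rewrite e; apply: eq_bigr => i _; rewrite !mxE pE.
  have P0 (o : 'I_4) (i : 'I_h) : (p o i = 0) -> P i o = 0 by rewrite pE.
  apply/matrixP => i a; rewrite mxE; case: a => [] [|[|[|[|//]]]] ha.
  - transitivity (P i o0); first by congr (P _ _); apply: val_inj.
    by rewrite P0 // e0 // c10 c20; ring.
  - transitivity (P i o1); first by congr (P _ _); apply: val_inj.
    by rewrite P0 // e1 // c23 c20 c40; ring.
  - transitivity (P i o2); first by congr (P _ _); apply: val_inj.
    by rewrite P0 // e2 // d10 d20; ring.
  - transitivity (P i o3); first by congr (P _ _); apply: val_inj.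
    by rewrite P0 // e3 // d23 d20 d40; ring.
pose d := 1 + `|a1| + `|a2|.
have lamd a : lam 0 a != d.
  have h1 := ler_norm a1; have h2 := ler_norm a2.
  have g1 := normr_ge0 a1; have g2 := normr_ge0 a2.
  by rewrite lt_eqF // mxE /d; case: ifP => _; lra.
have [] := @perturb_in_SG R n 4 G (embed_mx f B d) (embed_cols (n := n) f W) lam simpleG.
- exact: embed_mx_sym.
- move=> i j ij /(embed_mx_offdiag f_inj ij) [a [c [ia jc Bac]]].
  rewrite ia jc; apply: bG => //; last by move: Bac; rewrite mxE.
  by move: ij; rewrite ia jc (inj_eq f_inj).
- exact: embed_eigen.
- exact: embed_transversal.
- exact: embed_cols_inj.
move=> A [W1 [SGA AW1 W1_inj]].
have symA := proj1 SGA.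
have colW a : A *m col a W1 = lam 0 a *: col a W1.
  rewrite colE mulmxA AW1 -!colE.
  by apply/matrixP => i j; rewrite mul_mx_diag !mxE mulrC.
have rank_ge mu oa ob : oa != ob -> (forall a, (lam 0 a == mu) = (a \in [:: oa; ob])) ->
    (1 < \rank (eigenspace A mu))%N.
  move=> oab lamE; pose g (i : 'I_2) := if i == 0 then oa else ob.
  have oba := oab; rewrite eq_sym in oba.
  have gE a : (a \in codom g) = (a \in [:: oa; ob]).
    apply/codomP/idP => [[i ->]|].
      by rewrite /g !inE; case: ifP => _; rewrite eqxx ?orbT.
    by rewrite !inE => /orP[] /eqP ->; [exists 0 | exists 1].
  apply: (@rank_eigenspace_ge R n 4 2 A W1 mu g) => //.
  - move=> [[|[|//]] h1] [[|[|//]] h2]; rewrite /g //= => e; apply: val_inj => //=.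
      by rewrite e eqxx in oab.
    by rewrite e eqxx in oab.
  - move=> a; rewrite colW; congr (_ *: _); apply/eqP.
    by rewrite lamE -gE codom_f.
  - move=> x xg; apply: (W1_inj mu) => a amu; apply: xg.
    by rewrite gE -lamE.
apply: (@no_two_defects A a1 a2) => //; rewrite (negbTE a12).
- apply: (rank_ge a1 o0 o1) => // -[] [|[|[|[|//]]]] ha; rewrite mxE /= ?eqxx //.
  + by rewrite eq_sym (negbTE a12).
  + by rewrite eq_sym (negbTE a12).
- apply: (rank_ge a2 o2 o3) => // -[] [|[|[|[|//]]]] ha; rewrite mxE /= ?eqxx //.
  + by rewrite (negbTE a12).
  + by rewrite (negbTE a12).
Qed.
End Forbidden.

(** * Three small patterns: cricket, spider and net *)

Section SmallForbidden.
Variable R : realType.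

Definition table (t : seq (seq R)) (i j : nat) : R := nth 0 (nth [::] t i) j.

(** The [foldr] form unfolds by computation, so a concrete table turns into a linear system for
    [lra]. *)
Lemma is_eigvecE (h : nat) (b : nat -> nat -> R) (a : R) (p : nat -> R) :
  is_eigvec h b a p <-> forall i, (i < h)%N ->
    foldr (fun j s => b i j * p j + s) 0 (iota 0 h) = a * p i.
Proof.
have E i : \sum_(j < h) b i j * p j = foldr (fun j s => b i j * p j + s) 0 (iota 0 h).
  rewrite -(big_mkord xpredT (fun j => b i j * p j)) /index_iota subn0.
  by elim: (iota 0 h) => [|c s IH]; rewrite ?big_nil ?big_cons //= IH.
by split=> e i /e; rewrite E.
Qed.

(** The triangle 0, 1, 2 with pendant vertices 3 and 4 at 0, weighted to have the spectrum -2, 0, 0,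
    2, 2. *)
Definition cricket_table : nat -> nat -> R := table
  [:: [:: 0; 1; 1; 1; 1];
      [:: 1; 1; -1; 0; 0];
      [:: 1; -1; 1; 0; 0];
      [:: 1; 0; 0; 0; 0];
      [:: 1; 0; 0; 0; 0]].

Lemma cricket_stable : two_stable_double_eigenvalues 5 cricket_table.
Proof.
exists 0, 2, (nth 0 [:: 0; 0; 0; 1; -1]), (nth 0 [:: 0; 1; 1; -1; -1]),
  (nth 0 [:: 0; 1; -1; 0; 0]), (nth 0 [:: 2; 1; 1; 1; 1]).
split.
- by rewrite eq_sym pnatr_eq0.
- split.
  + by apply/is_eigvecE => -[|[|[|[|[|i]]]]] // _; rewrite /cricket_table /table /=; lra.
  + by apply/is_eigvecE => -[|[|[|[|[|i]]]]] // _; rewrite /cricket_table /table /=; lra.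
  + move=> p /is_eigvecE e.
    have := (e 0%N isT, e 1%N isT, e 2%N isT, e 3%N isT, e 4%N isT).
    rewrite /cricket_table /table /=.
    move=> [[[[e0 e1] e2] e3] e4] {e}.
    exists ((p 3%N - p 4%N) / 2), (p 1%N).
    by move=> [|[|[|[|[|i]]]]] // _ /=; lra.
- split.
  + by apply/is_eigvecE => -[|[|[|[|[|i]]]]] // _; rewrite /cricket_table /table /=; lra.
  + by apply/is_eigvecE => -[|[|[|[|[|i]]]]] // _; rewrite /cricket_table /table /=; lra.
  + move=> p /is_eigvecE e.
    have := (e 0%N isT, e 1%N isT, e 2%N isT, e 3%N isT, e 4%N isT).
    rewrite /cricket_table /table /=.
    move=> [[[[e0 e1] e2] e3] e4] {e}.
    exists ((p 1%N - p 2%N) / 2), (p 3%N).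
    by move=> [|[|[|[|[|i]]]]] // _ /=; lra.
- move=> y1 y2 y3 z1 z2 z3 e.
  have n1 := oner_neq0 R; have n2 : -1 != 0 :> R by rewrite oppr_eq0.
  have := (e 0%N 0%N isT isT isT, e 1%N 1%N isT isT isT, e 2%N 2%N isT isT isT,
    e 3%N 3%N isT isT isT, e 4%N 4%N isT isT isT, e 0%N 1%N isT isT n1,
    e 0%N 2%N isT isT n1, e 0%N 3%N isT isT n1, e 0%N 4%N isT isT n1,
    e 1%N 2%N isT isT n2).
  rewrite /quad_entry /=.
  move=> [[[[[[[[[e1 e2] e3] e4] e5] e6] e7] e8] e9] e10] {e}.
  by split; split; lra.
Qed.

(** Each leg carries the block with rows (1, -1) and (-1, 1), of eigenvalues 0 and 2. For each of
    them, the combinations of the eigenvectors of the three legs that cancel at the centre form a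
    plane. *)
Definition spider_table : nat -> nat -> R := table
  [:: [:: 0; 1; 1; 1; 0; 0; 0];
      [:: 1; 1; 0; 0; -1; 0; 0];
      [:: 1; 0; 1; 0; 0; -1; 0];
      [:: 1; 0; 0; 1; 0; 0; -1];
      [:: 0; -1; 0; 0; 1; 0; 0];
      [:: 0; 0; -1; 0; 0; 1; 0];
      [:: 0; 0; 0; -1; 0; 0; 1]].

Lemma spider_stable : two_stable_double_eigenvalues 7 spider_table.
Proof.
exists 0, 2, (nth 0 [:: 0; 1; -1; 0; 1; -1; 0]), (nth 0 [:: 0; 1; 0; -1; 1; 0; -1]),
  (nth 0 [:: 0; 1; -1; 0; -1; 1; 0]), (nth 0 [:: 0; 1; 0; -1; -1; 0; 1]).
split.
- by rewrite eq_sym pnatr_eq0.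
- split.
  + by apply/is_eigvecE => -[|[|[|[|[|[|[|i]]]]]]] // _; rewrite /spider_table /table /=; lra.
  + by apply/is_eigvecE => -[|[|[|[|[|[|[|i]]]]]]] // _; rewrite /spider_table /table /=; lra.
  + move=> p /is_eigvecE e.
    have := (e 0%N isT, e 1%N isT, e 2%N isT, e 3%N isT, e 4%N isT, e 5%N isT, e 6%N isT).
    rewrite /spider_table /table /=.
    move=> [[[[[[e0 e1] e2] e3] e4] e5] e6] {e}.
    exists (- p 2%N), (- p 3%N).
    by move=> [|[|[|[|[|[|[|i]]]]]]] // _ /=; lra.
- split.
  + by apply/is_eigvecE => -[|[|[|[|[|[|[|i]]]]]]] // _; rewrite /spider_table /table /=; lra.
  + by apply/is_eigvecE => -[|[|[|[|[|[|[|i]]]]]]] // _; rewrite /spider_table /table /=; lra.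
  + move=> p /is_eigvecE e.
    have := (e 0%N isT, e 1%N isT, e 2%N isT, e 3%N isT, e 4%N isT, e 5%N isT, e 6%N isT).
    rewrite /spider_table /table /=.
    move=> [[[[[[e0 e1] e2] e3] e4] e5] e6] {e}.
    exists (- p 2%N), (- p 3%N).
    by move=> [|[|[|[|[|[|[|i]]]]]]] // _ /=; lra.
- move=> y1 y2 y3 z1 z2 z3 e.
  have n1 := oner_neq0 R; have n2 : -1 != 0 :> R by rewrite oppr_eq0.
  have := (e 0%N 0%N isT isT isT, e 1%N 1%N isT isT isT, e 2%N 2%N isT isT isT,
    e 3%N 3%N isT isT isT, e 4%N 4%N isT isT isT, e 5%N 5%N isT isT isT,
    e 6%N 6%N isT isT isT, e 0%N 1%N isT isT n1, e 0%N 2%N isT isT n1,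
    e 0%N 3%N isT isT n1, e 1%N 4%N isT isT n2, e 2%N 5%N isT isT n2,
    e 3%N 6%N isT isT n2).
  rewrite /quad_entry /=.
  move=> [[[[[[[[[[[[e1 e2] e3] e4] e5] e6] e7] e8] e9] e10] e11] e12] e13] {e}.
  by split; split; lra.
Qed.

(** The triangle carries the all-ones matrix, which kills vectors of sum zero. On [(x, x)] and
    [(x, -x)] with [x] of sum zero only the pendant edges act, with eigenvalues 1 and -1. *)
Definition net_table : nat -> nat -> R := table
  [:: [:: 1; 1; 1; 1; 0; 0];
      [:: 1; 1; 1; 0; 1; 0];
      [:: 1; 1; 1; 0; 0; 1];
      [:: 1; 0; 0; 0; 0; 0];
      [:: 0; 1; 0; 0; 0; 0];
      [:: 0; 0; 1; 0; 0; 0]].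

Lemma net_stable : two_stable_double_eigenvalues 6 net_table.
Proof.
exists 1, (-1), (nth 0 [:: 1; -1; 0; 1; -1; 0]), (nth 0 [:: 1; 0; -1; 1; 0; -1]),
  (nth 0 [:: 1; -1; 0; -1; 1; 0]), (nth 0 [:: 1; 0; -1; -1; 0; 1]).
split.
- by apply/eqP; lra.
- split.
  + by apply/is_eigvecE => -[|[|[|[|[|[|i]]]]]] // _; rewrite /net_table /table /=; lra.
  + by apply/is_eigvecE => -[|[|[|[|[|[|i]]]]]] // _; rewrite /net_table /table /=; lra.
  + move=> p /is_eigvecE e.
    have := (e 0%N isT, e 1%N isT, e 2%N isT, e 3%N isT, e 4%N isT, e 5%N isT).
    rewrite /net_table /table /=.
    move=> [[[[[e0 e1] e2] e3] e4] e5] {e}.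
    exists (- p 1%N), (- p 2%N).
    by move=> [|[|[|[|[|[|i]]]]]] // _ /=; lra.
- split.
  + by apply/is_eigvecE => -[|[|[|[|[|[|i]]]]]] // _; rewrite /net_table /table /=; lra.
  + by apply/is_eigvecE => -[|[|[|[|[|[|i]]]]]] // _; rewrite /net_table /table /=; lra.
  + move=> p /is_eigvecE e.
    have := (e 0%N isT, e 1%N isT, e 2%N isT, e 3%N isT, e 4%N isT, e 5%N isT).
    rewrite /net_table /table /=.
    move=> [[[[[e0 e1] e2] e3] e4] e5] {e}.
    exists (- p 1%N), (- p 2%N).
    by move=> [|[|[|[|[|[|i]]]]]] // _ /=; lra.
- move=> y1 y2 y3 z1 z2 z3 e.
  have n1 := oner_neq0 R; have n2 : -1 != 0 :> R by rewrite oppr_eq0.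
  have := (e 0%N 0%N isT isT isT, e 1%N 1%N isT isT isT, e 2%N 2%N isT isT isT,
    e 3%N 3%N isT isT isT, e 4%N 4%N isT isT isT, e 5%N 5%N isT isT isT,
    e 0%N 1%N isT isT n1, e 0%N 2%N isT isT n1, e 0%N 3%N isT isT n1,
    e 1%N 2%N isT isT n1, e 1%N 4%N isT isT n1, e 2%N 5%N isT isT n1).
  rewrite /quad_entry /=.
  move=> [[[[[[[[[[[e1 e2] e3] e4] e5] e6] e7] e8] e9] e10] e11] e12] {e}.
  by split; split; lra.
Qed.

End SmallForbidden.

Lemma sum_ord_supp (R : realType) (h : nat) (F : nat -> R) (l : seq nat) :
  uniq l -> all (fun j => j < h)%N l ->
  (forall j, (j < h)%N -> j \notin l -> F j = 0) ->
  \sum_(j < h) F j = \sum_(j <- l) F j.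
Proof.
move=> ul lh F0; rewrite -(big_mkord xpredT F).
rewrite (bigID (mem l)) /= [X in _ + X]big1_seq ?addr0; last first.
  by move=> j /andP[jl]; rewrite mem_index_iota => /andP[_ jh]; exact: F0.
rewrite -big_filter; apply: perm_big; apply: uniq_perm => //.
  by rewrite filter_uniq // iota_uniq.
move=> j; rewrite mem_filter mem_index_iota /=.
by case: (boolP (j \in l)) => //= /(allP lh) ->.
Qed.

(** * Cycles of length at least four *)

Section Cycle.
Variable R : realType.

(* The minus sign on the closing edge makes [cos (phi r)] and [sin (phi r)]
   eigenvectors whenever [cos (k phi) = -1]; this works for every [k >= 4],
   whereas the untwisted cycle of length 4 has a single double eigenvalue. *)
Definition twisted_cycle (k i j : nat) : R :=
  if (j == i.+1) || (i == j.+1) then 1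
  else if ((i == 0%N) && (j == k.-1)) || ((j == 0%N) && (i == k.-1)) then -1 else 0.

Lemma twisted_cycle_sym k i j : twisted_cycle k i j = twisted_cycle k j i.
Proof. by rewrite /twisted_cycle orbC [in X in if _ then _ else X]orbC. Qed.

Let twE k i j : twisted_cycle k i j =
  if (j == i.+1) || (i == j.+1) then 1
  else if ((i == 0%N) && (j == k.-1)) || ((j == 0%N) && (i == k.-1)) then -1 else 0.
Proof. by []. Qed.

Let tw1 k i j : (j == i.+1) || (i == j.+1) -> twisted_cycle k i j = 1.
Proof. by rewrite twE => ->. Qed.

Let twN1 k i j : (3 < k)%N -> (i == 0%N) && (j == k.-1) || (j == 0%N) && (i == k.-1) ->
  twisted_cycle k i j = -1.
Proof. by move=> k3 h; rewrite twE h ifF //; lia. Qed.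

Let tw0 k i j : (j == i.+1) || (i == j.+1) = false ->
  (i == 0%N) && (j == k.-1) || (j == 0%N) && (i == k.-1) = false ->
  twisted_cycle k i j = 0.
Proof. by rewrite twE => -> ->. Qed.

Lemma twisted_cycle_first k (p : nat -> R) : (3 < k)%N ->
  \sum_(j < k) twisted_cycle k 0 j * p j = p 1%N - p k.-1.
Proof.
move=> k3; rewrite (@sum_ord_supp _ _ (fun j => twisted_cycle k 0 j * p j) [:: 1%N; k.-1]) /=.
- by rewrite !big_cons big_nil tw1 // twN1 ?eqxx //; ring.
- by rewrite inE; lia.
- lia.
- by move=> j jk; rewrite !inE => jn; rewrite tw0 ?mul0r //; lia.
Qed.

Lemma twisted_cycle_last k (p : nat -> R) : (3 < k)%N ->
  \sum_(j < k) twisted_cycle k k.-1 j * p j = p k.-2 - p 0%N.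
Proof.
move=> k3; rewrite (@sum_ord_supp _ _ (fun j => twisted_cycle k k.-1 j * p j) [:: k.-2; 0%N]) /=.
- by rewrite !big_cons big_nil tw1 ?twN1 ?eqxx ?orbT //; [ring | lia].
- by rewrite inE; lia.
- lia.
- by move=> j jk; rewrite !inE => jn; rewrite tw0 ?mul0r //; lia.
Qed.

Lemma twisted_cycle_mid k i (p : nat -> R) : (i.+2 < k)%N ->
  \sum_(j < k) twisted_cycle k i.+1 j * p j = p i + p i.+2.
Proof.
move=> ik; rewrite (@sum_ord_supp _ _ (fun j => twisted_cycle k i.+1 j * p j) [:: i; i.+2]) /=.
- by rewrite !big_cons big_nil !tw1 ?eqxx ?orbT //; ring.
- by rewrite inE; lia.
- lia.
- by move=> j jk; rewrite !inE => jn; rewrite tw0 ?mul0r //; lia.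
Qed.

Section Wave.
Variables (k : nat) (phi : R).
Hypothesis k3 : (3 < k)%N.
Hypothesis cosk : cos (phi * k%:R) = -1.
Hypothesis sinphi : sin phi != 0.

Let C (r : nat) := cos (phi * r%:R).
Let S (r : nat) := sin (phi * r%:R).

Let sink : sin (phi * k%:R) = 0.
Proof. by apply: cos1sin0; rewrite cosk normrN1. Qed.

Let C0 : C 0 = 1. Proof. by rewrite /C mulr0 cos0. Qed.
Let S0 : S 0 = 0. Proof. by rewrite /S mulr0 sin0. Qed.
Let C1 : C 1 = cos phi. Proof. by rewrite /C mulr1. Qed.
Let S1 : S 1 = sin phi. Proof. by rewrite /S mulr1. Qed.

Let CS r : C r.+1 = C r * cos phi - S r * sin phi.
Proof. by rewrite /C -addn1 natrD mulrDr mulr1 cosD. Qed.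
Let SS r : S r.+1 = S r * cos phi + C r * sin phi.
Proof. by rewrite /S -addn1 natrD mulrDr mulr1 sinD. Qed.

Lemma wave_rec_cos r : C r + C r.+2 = 2 * cos phi * C r.+1.
Proof.
have e := cos2Dsin2 phi; have e' : sin phi ^+ 2 = 1 - cos phi ^+ 2 by lra.
rewrite [C r.+2]CS [S r.+1]SS [C r.+1]CS.
have -> : C r + ((C r * cos phi - S r * sin phi) * cos phi -
  (S r * cos phi + C r * sin phi) * sin phi) =
  C r * (1 - sin phi ^+ 2) + C r * cos phi ^+ 2 - 2 * cos phi * S r * sin phi by ring.
by rewrite e'; ring.
Qed.

Lemma wave_rec_sin r : S r + S r.+2 = 2 * cos phi * S r.+1.
Proof.
have e := cos2Dsin2 phi; have e' : sin phi ^+ 2 = 1 - cos phi ^+ 2 by lra.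
rewrite [S r.+2]SS [C r.+1]CS [S r.+1]SS.
have -> : S r + ((S r * cos phi + C r * sin phi) * cos phi +
  (C r * cos phi - S r * sin phi) * sin phi) =
  S r * (1 - sin phi ^+ 2) + S r * cos phi ^+ 2 + 2 * cos phi * C r * sin phi by ring.
by rewrite e'; ring.
Qed.

Let CS2 r : C r ^+ 2 + S r ^+ 2 = 1. Proof. exact: cos2Dsin2. Qed.

(** The recurrence continues [p] to the index [k], where [p k = - p 0] stands for the twisted
    closing edge in the last row. *)
Lemma wave_eigen (p : nat -> R) : (forall r, p r + p r.+2 = 2 * cos phi * p r.+1) ->
  p 1%N - p k.-1 = 2 * cos phi * p 0%N -> p k = - p 0%N ->
  is_eigvec k (twisted_cycle k) (2 * cos phi) p.
Proof.
move=> prec p0 pk [|i] ik; first by rewrite twisted_cycle_first // p0.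
have [ik1|] := ltnP i.+2 k; first by rewrite twisted_cycle_mid // prec.
move=> ki; have ei : i.+1 = k.-1 by lia.
rewrite ei twisted_cycle_last // -ei -prec.
rewrite /=.
by have <- : k = i.+2 by [lia]; rewrite pk.
Qed.

Lemma wave_eigenspace :
  eigenspace_basis k (twisted_cycle k) (2 * cos phi) C S.
Proof.
have kS : k = k.-1.+1 by lia.
have Ck : C k.-1 = - cos phi.
  have := CS k.-1; have := SS k.-1; rewrite -kS [C k]cosk [S k]sink => e1 e2.
  have := CS2 k.-1; have := cos2Dsin2 phi => h1 h2.
  have : C k.-1 * (cos phi ^+ 2 + sin phi ^+ 2) = - cos phi.
    have -> : C k.-1 * (cos phi ^+ 2 + sin phi ^+ 2) =
      (C k.-1 * cos phi - S k.-1 * sin phi) * cos phi +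
      (S k.-1 * cos phi + C k.-1 * sin phi) * sin phi by ring.
    by rewrite -e1 -e2; ring.
  by rewrite h1 mulr1.
have Sk : S k.-1 = sin phi.
  have := CS k.-1; have := SS k.-1; rewrite -kS [C k]cosk [S k]sink => e1 e2.
  have h1 := cos2Dsin2 phi.
  have : S k.-1 * (cos phi ^+ 2 + sin phi ^+ 2) = sin phi.
    have -> : S k.-1 * (cos phi ^+ 2 + sin phi ^+ 2) =
      - (C k.-1 * cos phi - S k.-1 * sin phi) * sin phi +
      (S k.-1 * cos phi + C k.-1 * sin phi) * cos phi by ring.
    by rewrite -e1 -e2; ring.
  by rewrite h1 mulr1.
split.
- apply: wave_eigen; first exact: wave_rec_cos.
  + by rewrite C1 Ck C0; ring.
  + by rewrite C0 [LHS]cosk.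
- apply: wave_eigen; first exact: wave_rec_sin.
  + by rewrite S1 Sk S0; ring.
  + by rewrite S0 [LHS]sink oppr0.
(* The recurrence determines [p] by its values at 0 and 1, and [sin phi != 0] lets [C] and [S] take
   any two values there. *)
move=> p ep; exists (p 0%N), ((p 1%N - p 0%N * cos phi) / sin phi).
have : forall i, (i.+1 < k)%N -> 
    p i = p 0%N * C i + (p 1%N - p 0%N * cos phi) / sin phi * S i /\
    p i.+1 = p 0%N * C i.+1 + (p 1%N - p 0%N * cos phi) / sin phi * S i.+1.
  elim=> [_|i IH ik].
    by split; rewrite ?C0 ?S0 ?C1 ?S1; field.
  have [e1 e2] := IH (ltnW ik); split => //.
  have := ep i.+1 (ltnW ik); rewrite twisted_cycle_mid // => e3.
  have rc := wave_rec_cos i; have rs := wave_rec_sin i.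
  have -> : p i.+2 = 2 * cos phi * p i.+1 - p i by lra.
  have -> : C i.+2 = 2 * cos phi * C i.+1 - C i by lra.
  have -> : S i.+2 = 2 * cos phi * S i.+1 - S i by lra.
  by rewrite e1 e2; ring.
move=> H [|i] ik; first by have [] := H 0%N ltac:(lia).
by have [] := H i ik.
Qed.

(** By the addition formulas the diagonal and the edge entries are, up to a constant for each
    parity, the values at [t = 2 r] and [t = 2 r + 1] of one sequence of frequency [phi] in [t]. Two
    eigenspaces then give the situation of [two_frequencies]. *)
Lemma wave_quad_diag (y1 y2 y3 : R) r : quad_entry C S y1 y2 y3 r r =
  (y1 + y3) / 2 + ((y1 - y3) / 2 * C r.*2 + y2 * S r.*2).
Proof.
have -> : C r.*2 = C r ^+ 2 - S r ^+ 2.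
  by rewrite /C /S -addnn natrD mulrDr cosD !expr2.
have -> : S r.*2 = 2 * (C r * S r) by rewrite /C /S -addnn natrD mulrDr sinD; ring.
have -> : (y1 + y3) / 2 = (y1 + y3) / 2 * (C r ^+ 2 + S r ^+ 2).
  by rewrite CS2 mulr1.
by rewrite /quad_entry; field.
Qed.

Lemma wave_quad_edge (y1 y2 y3 : R) r : quad_entry C S y1 y2 y3 r r.+1 =
  (y1 + y3) / 2 * cos phi + ((y1 - y3) / 2 * C r.*2.+1 + y2 * S r.*2.+1).
Proof.
have rE : (r.*2.+1 = r + r.+1)%N by rewrite addnS addnn.
have -> : C r.*2.+1 = C r * C r.+1 - S r * S r.+1.
  by rewrite rE /C /S natrD mulrDr cosD.
have -> : S r.*2.+1 = S r * C r.+1 + C r * S r.+1.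
  by rewrite rE /C /S natrD mulrDr sinD.
have -> : cos phi = C r * C r.+1 + S r * S r.+1.
  rewrite CS SS -[LHS]mulr1 -(CS2 r); ring.
by rewrite /quad_entry; field.
Qed.
End Wave.

(* The operators [f t + f (t+2) - a f (t+1)] and [f t + f (t+2) - b f (t+1)] kill
   [g] and [k] respectively, and act invertibly on the parity-dependent constant. *)
Lemma two_frequencies (a b S T : R) (g k : nat -> R) :
  a != b -> `|a| < 2 -> `|b| < 2 ->
  (forall t, g t + g t.+2 = a * g t.+1) ->
  (forall t, k t + k t.+2 = b * k t.+1) ->
  (forall r, (r < 4)%N -> S + (g r.*2 + k r.*2) = 0) ->
  (forall r, (r < 3)%N -> T + (g r.*2.+1 + k r.*2.+1) = 0) ->
  [/\ S = 0, T = 0, g 0%N = 0 /\ g 1%N = 0 & k 0%N = 0 /\ k 1%N = 0].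
Proof.
rewrite !ltr_norml => ab /andP[a1 a2] /andP[b1 b2] gr kr evn odd.
have ab0 : a - b != 0 by rewrite subr_eq0.
have even0 := evn 0%N isT; have even1 := evn 1%N isT; have even2 := evn 2 isT.
have even3 := evn 3 isT; have odd0 := odd 0%N isT; have odd1 := odd 1%N isT.
have odd2 := odd 2 isT; rewrite /= in even0 even1 even2 even3 odd0 odd1 odd2.
have k0 : k 0%N = - S - g 0%N by lra.
have k1 : k 1%N = - T - g 1%N by lra.
have k2 : k 2%N = - S - g 2%N by lra.
have k3 : k 3%N = - T - g 3%N by lra.
have k4 : k 4%N = - S - g 4%N by lra.
have k5 : k 5%N = - T - g 5%N by lra.
have h1 : (a - b) * g 1%N = b * T - 2 * S.
  have := kr 0%N; rewrite k0 k1 k2 => e; have := gr 0%N; lra.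
have h2 : (a - b) * g 2%N = b * S - 2 * T.
  have := kr 1%N; rewrite k1 k2 k3 => e; have := gr 1%N; lra.
have h3 : (a - b) * g 3%N = b * T - 2 * S.
  have := kr 2%N; rewrite k2 k3 k4 => e; have := gr 2%N; lra.
have h4 : (a - b) * g 4%N = b * S - 2 * T.
  have := kr 3%N; rewrite k3 k4 k5 => e; have := gr 3%N; lra.
have c2 : 2 * (b * T - 2 * S) - a * (b * S - 2 * T) = 0.
  rewrite -h2 -{1}h1 -[RHS](mulr0 (a - b)).
  have -> : 0 = g 1%N + g 3%N - a * g 2%N by rewrite gr subrr.
  have : (a - b) * g 3%N = (a - b) * g 1%N by rewrite h3 h1.
  by move=> e; rewrite mulrBr mulrDr e; ring.
have c3 : 2 * (b * S - 2 * T) - a * (b * T - 2 * S) = 0.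
  rewrite -h3 -{1}h2 -[RHS](mulr0 (a - b)).
  have -> : 0 = g 2%N + g 4%N - a * g 3%N by rewrite gr subrr.
  have : (a - b) * g 4%N = (a - b) * g 2%N by rewrite h4 h2.
  by move=> e; rewrite mulrBr mulrDr e; ring.
have D0 : S + T = 0.
  have : (2 - a) * (b - 2) * (S + T) = 0 by lra.
  by move=> /eqP; rewrite !mulf_eq0 => /orP[/orP[]/eqP|/eqP //]; lra.
have E0 : S - T = 0.
  have : (2 + a) * (b + 2) * (S - T) = 0 by lra.
  by move=> /eqP; rewrite !mulf_eq0 => /orP[/orP[]/eqP|/eqP //]; lra.
have S0 : S = 0 by lra.
have T0 : T = 0 by lra.
have g1 : g 1%N = 0.
  by apply/eqP; move/eqP: h1; rewrite S0 T0 !mulr0 subrr mulf_eq0 (negbTE ab0).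
have g2 : g 2%N = 0.
  by apply/eqP; move/eqP: h2; rewrite S0 T0 !mulr0 subrr mulf_eq0 (negbTE ab0).
have g0 : g 0%N = 0 by have := gr 0%N; rewrite g1 g2; lra.
by split => //; split => //; lra.
Qed.

Lemma twisted_cycle_stable k : (3 < k)%N ->
  two_stable_double_eigenvalues k (twisted_cycle k).
Proof.
move=> k3; have lt4k r : (r < 4)%N -> (r < k)%N by lia.
have pi0 := pi_gt0 R.
have kR : 0 < k%:R :> R by rewrite ltr0n; lia.
have kR3 : 3 < k%:R :> R by rewrite ltr_nat.
(* Both angles are odd multiples of [pi / k], so the waves change sign after [k] steps. As [k > 3],
   both lie strictly between 0 and [pi], so their cosines differ. *)
pose th : R := pi / k%:R; pose ph : R := 3 * th.
have thk : th * k%:R = pi by rewrite /th mulfVK // gt_eqF.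
have th0 : 0 < th by rewrite divr_gt0.
have ph1 : ph < pi by rewrite -thk /ph mulrC ltr_pM2l.
have sth : sin th != 0 by rewrite gt_eqF // sin_gt0_pi // th0 /=; rewrite /ph in ph1; lra.
have sph : sin ph != 0 by rewrite gt_eqF // sin_gt0_pi // ph1 andbT /ph; lra.
have cth : cos (th * k%:R) = -1 by rewrite thk cospi.
have cph : cos (ph * k%:R) = -1.
  have e : 3 * pi = pi *+ 2 + pi :> R by rewrite mulr2n; ring.
  by rewrite /ph -mulrA thk e cosDpi cos2pi.
have neq : cos th != cos ph.
  apply/negP => /eqP /cos_inj; rewrite !in_itv /= => e.
  suff : th = ph by rewrite /ph; lra.
  by apply: e; rewrite /ph in ph1 *; apply/andP; split; lra.
have bnd (x : R) : sin x != 0 -> `|2 * cos x| < 2.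
  move=> sx; rewrite normrM (@ger0_norm _ 2) // -[ltRHS]mulr1 ltr_pM2l //.
  rewrite lt_neqAle cos_max andbT; apply/negP => /eqP /cos1sin0 s0.
  by rewrite s0 eqxx in sx.
exists (2 * cos th), (2 * cos ph), (fun r => cos (th * r%:R)), (fun r => sin (th * r%:R)),
  (fun r => cos (ph * r%:R)), (fun r => sin (ph * r%:R)).
have ab : 2 * cos th != 2 * cos ph.
  by apply/negP => /eqP e; move/negP: neq; apply; apply/eqP; lra.
split=> //; [exact: wave_eigenspace | exact: wave_eigenspace |].
move=> y1 y2 y3 z1 z2 z3 e.
pose g t := (y1 - y3) / 2 * cos (th * t%:R) + y2 * sin (th * t%:R).
pose kk t := (z1 - z3) / 2 * cos (ph * t%:R) + z2 * sin (ph * t%:R).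
have [||||S0 T0 [g0 g1] [k0 k1]] := @two_frequencies _ _ ((y1 + y3) / 2 + (z1 + z3) / 2)
  ((y1 + y3) / 2 * cos th + (z1 + z3) / 2 * cos ph) g kk ab (bnd _ sth) (bnd _ sph).
- move=> t; rewrite /g; have := wave_rec_cos th t; have := wave_rec_sin th t => r1 r2.
  rewrite addrACA -mulrDr r2 -mulrDr r1.
  by move: (cos (th * t.+1%:R)) (sin (th * t.+1%:R)) (cos th) => *; ring.
- move=> t; rewrite /kk; have := wave_rec_cos ph t; have := wave_rec_sin ph t => r1 r2.
  rewrite addrACA -mulrDr r2 -mulrDr r1.
  by move: (cos (ph * t.+1%:R)) (sin (ph * t.+1%:R)) (cos ph) => *; ring.
- move=> r r4; have rk := lt4k r r4.
  have := e r r rk rk; rewrite eqxx => /(_ isT); rewrite !wave_quad_diag => h.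
  by rewrite -[RHS]h /g /kk; ring.
- move=> r r3; have rk := lt4k r (ltnW r3).
  have rk1 := lt4k r.+1 r3.
  have := e r r.+1 rk rk1; rewrite /twisted_cycle eqxx oner_neq0 orbT => /(_ isT).
  by rewrite !wave_quad_edge => h; rewrite -[RHS]h /g /kk; ring.
move: g0 g1 k0 k1; rewrite /g /kk !mulr0 !mulr1 !cos0 !sin0 !mulr0 !addr0 !mulr1 => g0 g1 k0 k1.
have y13 : y1 = y3 by lra.
have z13 : z1 = z3 by lra.
have y20 : y2 = 0.
  by move: g1; rewrite g0 mul0r add0r => /eqP; rewrite mulf_eq0 (negbTE sth) orbF => /eqP.
have z20 : z2 = 0.
  by move: k1; rewrite k0 mul0r add0r => /eqP; rewrite mulf_eq0 (negbTE sph) orbF => /eqP.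
have zy : z1 = - y1 by lra.
have : y1 * (cos th - cos ph) = 0 by rewrite -[RHS]T0 -y13 -z13 zy; field.
move=> /eqP; rewrite mulf_eq0 subr_eq0 (negbTE neq) orbF => /eqP y10.
by split; split; lra.
Qed.
End Cycle.

(** * Two branch vertices on a path *)

Section DoubleBroom.
Variables (R : realType) (K : nat).
Hypothesis K0 : (0 < K)%N.
Let kr : R := K%:R.

(* The vertices are numbered so that [0 .. K+2] is a path whose second and
   next-to-last vertices [1] and [K+1] carry the further leaves [K+3] and [K+4].
   The weights make [j] at vertex [j+1] an eigenvector for 0 and [K-j] one for
   [-K] along the inner path. *)
Fixpoint broom_weight (j : nat) : R :=
  if j is i.+1 then broom_weight i + j%:R * (kr - j%:R) else kr.

Definition broom_edge (i : nat) : R :=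
  if (i == 0%N) || (i == K.+1) then kr else broom_weight i.-1.

(** At a vertex strictly inside the inner path the two eigenvector equations are linear in the
    diagonal entry and the next weight and determine both: this yields the last branch and the
    recursion of [broom_weight]. The entry at [K.+1] solves the equations at that end. *)
Definition broom_diag (i : nat) : R :=
  if (i == 0%N) || (i == K.+3) then 0
  else if (i == K.+2) || (i == K.+4) then - kr
  else if i == 1%N then 1
  else if i == K.+1 then - (broom_weight K.-1 * (kr - 1) + 2 * kr ^+ 2) / kr
  else - 2 * broom_weight i.-2 - i%:R * (kr - i.-1%:R).

Definition broom_support (i j : nat) : bool :=
  [|| (j == i.+1) && (j <= K.+2)%N, (i == 1%N) && (j == K.+3) | (i == K.+1) && (j == K.+4)].

Definition broom (i j : nat) : R :=
  if i == j then broom_diag i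
  else if broom_support i j then (if j == i.+1 then broom_edge i else kr)
  else if broom_support j i then (if i == j.+1 then broom_edge j else kr)
  else 0.

Let kr0 : kr != 0. Proof. by rewrite /kr pnatr_eq0; lia. Qed.
Let kr_gt0 : 0 < kr. Proof. by rewrite /kr ltr0n. Qed.

Lemma broom_sym i j : broom i j = broom j i.
Proof.
rewrite /broom (eq_sym j i); case: eqP => [-> //|ij].
case: (boolP (broom_support i j)) => s1; case: (boolP (broom_support j i)) => s2 //.
by exfalso; move: s1 s2; rewrite /broom_support; lia.
Qed.

Lemma broom_weight_gt0 j : (j < K)%N -> 0 < broom_weight j.
Proof.
elim: j => [|j IH] jK //=; apply: ltr_wpDr; last by apply: IH; lia.
by rewrite mulr_ge0 // subr_ge0 /kr ler_nat ltnW.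
Qed.

Let bD i : broom i i = broom_diag i. Proof. by rewrite /broom eqxx. Qed.

Let b1 i : (i <= K.+1)%N -> broom i i.+1 = broom_edge i.
Proof.
move=> iK; rewrite /broom /broom_support eqxx ltnS iK /=.
by have -> : (i == i.+1) = false by lia.
Qed.

Let b1' i : (i <= K.+1)%N -> broom i.+1 i = broom_edge i.
Proof. by move=> iK; rewrite broom_sym b1. Qed.

Let bl : broom 1 K.+3 = kr.
Proof.
rewrite /broom /broom_support !eqxx orbT.
by have -> : (K.+3 == 2)%N = false by lia.
Qed.

Let br : broom K.+1 K.+4 = kr.
Proof.
rewrite /broom /broom_support !eqxx !orbT.
have -> : (K.+1 == K.+4)%N = false by lia.
by have -> : (K.+4 == K.+2)%N = false by lia.
Qed.

Let bl' : broom K.+3 1 = kr. Proof. by rewrite broom_sym. Qed.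
Let br' : broom K.+4 K.+1 = kr. Proof. by rewrite broom_sym. Qed.

Let bN i j : i != j -> broom_support i j = false -> broom_support j i = false ->
  broom i j = 0.
Proof. by rewrite /broom => /negbTE -> -> ->. Qed.

Let supp i (p : nat -> R) l : uniq l -> all (fun j => j < K + 5)%N l ->
  (forall j, (j < K + 5)%N -> j \notin l ->
     [/\ i != j, broom_support i j = false & broom_support j i = false]) ->
  \sum_(j < K + 5) broom i j * p j = \sum_(j <- l) broom i j * p j.
Proof.
move=> ul al H; apply: (@sum_ord_supp _ _ (fun j => broom i j * p j)) => // j jK jl.
by have [h1 h2 h3] := H j jK jl; rewrite bN // mul0r.
Qed.

Let row0 (p : nat -> R) : \sum_(j < K + 5) broom 0 j * p j = kr * p 1%N.
Proof.
rewrite (@supp 0 p [:: 0; 1]%N);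
  [|by rewrite /= ?inE; lia|by rewrite /=; lia|]; last first.
  by move=> j jK; rewrite !inE /broom_support => jl; split; lia.
by rewrite !big_cons big_nil bD b1 // /broom_diag /broom_edge /=; ring.
Qed.

Let rowl (p : nat -> R) : \sum_(j < K + 5) broom K.+3 j * p j = kr * p 1%N.
Proof.
rewrite (@supp K.+3 p [:: K.+3; 1]%N);
  [|by rewrite /= ?inE; lia|by rewrite /=; lia|]; last first.
  by move=> j jK; rewrite !inE /broom_support => jl; split; lia.
by rewrite !big_cons big_nil bD bl' /broom_diag eqxx orbT; ring.
Qed.

Let rowy (p : nat -> R) :
  \sum_(j < K + 5) broom K.+2 j * p j = kr * p K.+1 - kr * p K.+2.
Proof.
rewrite (@supp K.+2 p [:: K.+1; K.+2]%N);
  [|by rewrite /= ?inE; lia|by rewrite /=; lia|]; last first.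
  by move=> j jK; rewrite !inE /broom_support => jl; split; lia.
rewrite !big_cons big_nil bD b1' // /broom_diag /broom_edge !eqxx orbT.
by have -> : (K.+2 == K.+3)%N = false by [lia]; rewrite /=; ring.
Qed.

Let rowy' (p : nat -> R) :
  \sum_(j < K + 5) broom K.+4 j * p j = kr * p K.+1 - kr * p K.+4.
Proof.
rewrite (@supp K.+4 p [:: K.+1; K.+4]%N);
  [|by rewrite /= ?inE; lia|by rewrite /=; lia|]; last first.
  by move=> j jK; rewrite !inE /broom_support => jl; split; lia.
rewrite !big_cons big_nil bD br' /broom_diag !eqxx orbT.
by have -> : (K.+4 == K.+3)%N = false by [lia]; rewrite /=; ring.
Qed.

Let row1 (p : nat -> R) : \sum_(j < K + 5) broom 1 j * p j =
  kr * p 0%N + p 1%N + kr * p 2%N + kr * p K.+3.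
Proof.
rewrite (@supp 1 p [:: 0; 1; 2; K.+3]%N);
  [|by rewrite /= ?inE; lia|by rewrite /=; lia|]; last first.
  by move=> j jK; rewrite !inE /broom_support => jl; split; lia.
rewrite !big_cons big_nil bD b1' // b1 ?bl ?ltnS // /broom_diag /broom_edge /=.
by have -> : (1 == K.+1)%N = false by [lia]; rewrite /=; ring.
Qed.

Let rowK (p : nat -> R) : \sum_(j < K + 5) broom K.+1 j * p j =
  broom_weight K.-1 * p K - (broom_weight K.-1 * (kr - 1) + 2 * kr ^+ 2) / kr * p K.+1
  + kr * p K.+2 + kr * p K.+4.
Proof.
rewrite (@supp K.+1 p [:: K; K.+1; K.+2; K.+4]%N);
  [|by rewrite /= ?inE; lia|by rewrite /=; lia|]; last first.
  by move=> j jK; rewrite !inE /broom_support => jl; split; lia.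
rewrite !big_cons big_nil bD b1' // b1 // br /broom_diag /broom_edge eqxx orbT.
have -> : (K == 0)%N || (K == K.+1)%N = false by lia.
have -> : (K.+1 == 0)%N || (K.+1 == K.+3)%N = false by lia.
have -> : (K.+1 == K.+2)%N || (K.+1 == K.+4)%N = false by lia.
by have -> : (K.+1 == 1)%N = false by [lia]; ring.
Qed.

Let rowj j (p : nat -> R) : (j.+1 < K)%N -> \sum_(j0 < K + 5) broom j.+2 j0 * p j0 =
  broom_weight j * p j.+1 + (- 2 * broom_weight j - j.+2%:R * (kr - j.+1%:R)) * p j.+2
  + broom_weight j.+1 * p j.+3.
Proof.
move=> jK; rewrite (@supp j.+2 p [:: j.+1; j.+2; j.+3]%N);
  [|by rewrite /= ?inE; lia|by rewrite /=; lia|]; last first.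
  by move=> i iK; rewrite !inE /broom_support => il; split; lia.
rewrite !big_cons big_nil bD b1' ?b1; [|lia|lia].
rewrite /broom_diag /broom_edge /=.
have -> : (j.+1 == K.+1)%N = false by lia.
have -> : (j.+2 == K.+1)%N = false by lia.
have -> : (j.+2 == K.+3)%N = false by lia.
have -> : (j.+2 == K.+2)%N || (j.+2 == K.+4)%N = false by lia.
by rewrite /=; ring.
Qed.

Let rows (a : R) (p : nat -> R) :
  kr * p 1%N = a * p 0%N -> kr * p 1%N = a * p K.+3 ->
  kr * p K.+1 - kr * p K.+2 = a * p K.+2 -> kr * p K.+1 - kr * p K.+4 = a * p K.+4 ->
  kr * p 0%N + p 1%N + kr * p 2%N + kr * p K.+3 = a * p 1%N ->
  broom_weight K.-1 * p K - (broom_weight K.-1 * (kr - 1) + 2 * kr ^+ 2) / kr * p K.+1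
    + kr * p K.+2 + kr * p K.+4 = a * p K.+1 ->
  (forall j, (j.+1 < K)%N ->
    broom_weight j * p j.+1 + (- 2 * broom_weight j - j.+2%:R * (kr - j.+1%:R)) * p j.+2
    + broom_weight j.+1 * p j.+3 = a * p j.+2) ->
  is_eigvec (K + 5) broom a p.
Proof.
move=> h0 hl hy hy' h1 hK hj [|[|j]] iK; first by rewrite row0.
  by rewrite row1.
have [jK|] := ltnP j.+1 K; first by rewrite rowj // hj.
rewrite leq_eqVlt => /orP[/eqP jE|]; first by rewrite -jE rowK.
rewrite leq_eqVlt => /orP[/eqP [jE]|]; first by rewrite -jE rowy.
rewrite leq_eqVlt => /orP[/eqP [jE]|Kj]; first by rewrite -jE rowl.
by have -> : j.+2 = K.+4 by [lia]; rewrite rowy'.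
Qed.

Let unrows (a : R) (p : nat -> R) : is_eigvec (K + 5) broom a p ->
  [/\ kr * p 1%N = a * p 0%N /\ kr * p 1%N = a * p K.+3,
  kr * p K.+1 - kr * p K.+2 = a * p K.+2 /\ kr * p K.+1 - kr * p K.+4 = a * p K.+4,
  kr * p 0%N + p 1%N + kr * p 2%N + kr * p K.+3 = a * p 1%N,
  broom_weight K.-1 * p K - (broom_weight K.-1 * (kr - 1) + 2 * kr ^+ 2) / kr * p K.+1
    + kr * p K.+2 + kr * p K.+4 = a * p K.+1 &
  (forall j, (j.+1 < K)%N ->
    broom_weight j * p j.+1 + (- 2 * broom_weight j - j.+2%:R * (kr - j.+1%:R)) * p j.+2
    + broom_weight j.+1 * p j.+3 = a * p j.+2)].
Proof.
move=> e; split.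
- by rewrite -[LHS]row0 e ?addnS // -rowl e //; lia.
- by rewrite -rowy -rowy' !e //; lia.
- by rewrite -row1 e //; lia.
- by rewrite -rowK e //; lia.
- by move=> j jK; rewrite -rowj // e //; lia.
Qed.

(** A leaf with diagonal entry [a] forces an eigenvector for [a] to vanish at its neighbour: at
    vertex 1 for 0, at [K.+1] for [- kr]. Hence the difference of the two leaves at that end is one
    eigenvector ([broom_u1], [broom_v1]); the other ([broom_u2], [broom_v2]) extends the inner path
    solution to the leaves. *)
Definition broom_u1 (i : nat) : R := if i == 0%N then 1 else if i == K.+3 then -1 else 0.
Definition broom_u2 (i : nat) : R :=
  if i == 0%N then -1 else if i == K.+3 then 0
  else if (i == K.+2) || (i == K.+4) then kr else i.-1%:R.
Definition broom_v1 (i : nat) : R := if i == K.+2 then 1 else if i == K.+4 then -1 else 0.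
Definition broom_v2 (i : nat) : R :=
  if (i == 0%N) || (i == K.+3) then - kr
  else if i == K.+2 then - broom_weight K.-1 / kr else if i == K.+4 then 0
  else kr - i.-1%:R.

Let inner i : (i <= K)%N -> [/\ broom_u1 i.+1 = 0, broom_u2 i.+1 = i%:R,
  broom_v1 i.+1 = 0 & broom_v2 i.+1 = kr - i%:R].
Proof.
move=> iK; rewrite /broom_u1 /broom_u2 /broom_v1 /broom_v2 /=.
have -> : (i.+1 == K.+3)%N = false by lia.
have -> : (i.+1 == K.+2)%N = false by lia.
by have -> : (i.+1 == K.+4)%N = false by lia.
Qed.

Let krS : K.-1%:R = kr - 1. Proof. by rewrite /kr -{2}(prednK K0) -natr1 addrK. Qed.

Let outer : [/\ broom_u1 K.+2 = 0, broom_u2 K.+2 = kr, broom_v1 K.+2 = 1 &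
    broom_v2 K.+2 = - broom_weight K.-1 / kr] /\
  [/\ broom_u1 K.+3 = -1, broom_u2 K.+3 = 0, broom_v1 K.+3 = 0 & broom_v2 K.+3 = - kr] /\
  [/\ broom_u1 K.+4 = 0, broom_u2 K.+4 = kr, broom_v1 K.+4 = -1 & broom_v2 K.+4 = 0].
Proof.
rewrite /broom_u1 /broom_u2 /broom_v1 /broom_v2 /= !eqxx.
have -> : (K.+2 == K.+3)%N = false by lia.
have -> : (K.+2 == K.+4)%N = false by lia.
have -> : (K.+3 == K.+2)%N = false by lia.
have -> : (K.+3 == K.+4)%N = false by lia.
have -> : (K.+4 == K.+2)%N = false by lia.
by have -> : (K.+4 == K.+3)%N = false by lia.
Qed.

Let at0 : [/\ broom_u1 0 = 1, broom_u2 0 = -1, broom_v1 0 = 0 & broom_v2 0 = - kr].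
Proof. by []. Qed.

Let atK : [/\ broom_u1 K = 0, broom_u2 K = kr - 1, broom_v1 K = 0 & broom_v2 K = 1].
Proof.
by have := inner (leq_pred K); rewrite prednK // krS; case=> -> -> -> ->; split=> //; ring.
Qed.

Let weightS j : broom_weight j.+1 = broom_weight j + j.+1%:R * (kr - j.+1%:R).
Proof. by []. Qed.

Let eig_u1 : is_eigvec (K + 5) broom 0 broom_u1.
Proof.
have [[o1 _ _ _] [[o2 _ _ _] [o3 _ _ _]]] := outer.
have [z _ _ _] := at0; have [k _ _ _] := atK.
have [i1 _ _ _] := inner (leq0n K); have [i2 _ _ _] := inner K0.
have [iK _ _ _] := inner (leqnn K).
apply: rows; rewrite ?o1 ?o2 ?o3 ?i1 ?i2 ?iK ?z ?k; try by ring.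
move=> j jK; have [-> _ _ _] := @inner j ltac:(lia).
have [-> _ _ _] := @inner j.+1 ltac:(lia); have [-> _ _ _] := @inner j.+2 ltac:(lia); ring.
Qed.

Let eig_u2 : is_eigvec (K + 5) broom 0 broom_u2.
Proof.
have [[_ o1 _ _] [[_ o2 _ _] [_ o3 _ _]]] := outer.
have [_ z _ _] := at0; have [_ k _ _] := atK.
have [_ i1 _ _] := inner (leq0n K); have [_ i2 _ _] := inner K0.
have [_ iK _ _] := inner (leqnn K).
apply: rows; rewrite ?o1 ?o2 ?o3 ?i1 ?i2 ?iK ?z ?k -/kr; try by ring.
  by field.
move=> j jK; have [_ -> _ _] := @inner j ltac:(lia).
have [_ -> _ _] := @inner j.+1 ltac:(lia); have [_ -> _ _] := @inner j.+2 ltac:(lia).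
by rewrite weightS -!natr1; ring.
Qed.

Let eig_v1 : is_eigvec (K + 5) broom (- kr) broom_v1.
Proof.
have [[_ _ o1 _] [[_ _ o2 _] [_ _ o3 _]]] := outer.
have [_ _ z _] := at0; have [_ _ k _] := atK.
have [_ _ i1 _] := inner (leq0n K); have [_ _ i2 _] := inner K0.
have [_ _ iK _] := inner (leqnn K).
apply: rows; rewrite ?o1 ?o2 ?o3 ?i1 ?i2 ?iK ?z ?k -/kr; try by ring.
move=> j jK; have [_ _ -> _] := @inner j ltac:(lia).
have [_ _ -> _] := @inner j.+1 ltac:(lia); have [_ _ -> _] := @inner j.+2 ltac:(lia); ring.
Qed.

Let eig_v2 : is_eigvec (K + 5) broom (- kr) broom_v2.
Proof.
have [[_ _ _ o1] [[_ _ _ o2] [_ _ _ o3]]] := outer.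
have [_ _ _ z] := at0; have [_ _ _ k] := atK.
have [_ _ _ i1] := inner (leq0n K); have [_ _ _ i2] := inner K0.
have [_ _ _ iK] := inner (leqnn K).
apply: rows; rewrite ?o1 ?o2 ?o3 ?i1 ?i2 ?iK ?z ?k -/kr; try by ring.
  by field.
move=> j jK; have [_ _ _ ->] := @inner j ltac:(lia).
have [_ _ _ ->] := @inner j.+1 ltac:(lia); have [_ _ _ ->] := @inner j.+2 ltac:(lia).
by rewrite weightS -!natr1; ring.
Qed.

Let cancel_kr x y : kr * x = kr * y -> x = y. Proof. exact: mulfI. Qed.

(** Leaf 0 forces [p 1 = 0]; the weights are positive, so the inner rows then determine the path
    values from [p 2]. *)
Let span_u p : is_eigvec (K + 5) broom 0 p ->
  exists c1 c2, forall i, (i < K + 5)%N -> p i = c1 * broom_u1 i + c2 * broom_u2 i.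
Proof.
move=> /unrows [[+ _] [hy hy'] h1 _ hj]; rewrite mul0r => /eqP.
rewrite mulf_eq0 (negbTE kr0) => /eqP p1.
have yE : p K.+2 = p K.+1 by apply: cancel_kr; lra.
have yE' : p K.+4 = p K.+1 by apply: cancel_kr; lra.
have inn : forall j, (j < K)%N -> p j.+1 = j%:R * p 2%N /\ p j.+2 = j.+1%:R * p 2%N.
  elim=> [|j IH] jK; first by rewrite p1 mul0r mul1r.
  have [e1 e2] := IH ltac:(lia); split => //.
  have := hj j jK; rewrite e1 e2 mul0r.
  have w0 := broom_weight_gt0 jK.
  move=> h; apply: (mulfI (lt0r_neq0 w0)).
  move: h; rewrite weightS -!natr1 => h.
  have -> : (broom_weight j + (j%:R + 1) * (kr - (j%:R + 1))) * p j.+3 = 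
    - (broom_weight j * (j%:R * p 2%N) +
       (-2 * broom_weight j - (j%:R + 1 + 1) * (kr - (j%:R + 1))) * ((j%:R + 1) * p 2%N)).
    by lra.
  by ring.
have inn' i : (i <= K)%N -> p i.+1 = i%:R * p 2%N.
  by case: i => [|i] iK; [rewrite p1 mul0r | have [] := inn i iK].
exists (- p K.+3), (p 2%N).
move: h1; rewrite p1 => h1.
have p0 : p 0%N = - p K.+3 - p 2%N by apply: cancel_kr; lra.
have [[o1 o1' _ _] [[o2 o2' _ _] [o3 o3' _ _]]] := outer.
have [z z' _ _] := at0.
move=> [|i] iK; first by rewrite z z' p0; ring.
have [iK'|] := leqP i K; first by have [-> -> _ _] := inner iK'; rewrite inn' //; ring.
rewrite leq_eqVlt => /orP[/eqP <-|]; first by rewrite o1 o1' yE inn' // -/kr; ring.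
rewrite leq_eqVlt => /orP[/eqP <-|Ki]; first by rewrite o2 o2'; ring.
have -> : i.+1 = K.+4 by lia.
by rewrite o3 o3' yE' inn' // -/kr; ring.
Qed.

(** The same propagation from the other end, where the leaves force [p K.+1 = 0]; [t] counts the
    steps back from there. *)
Let span_v p : is_eigvec (K + 5) broom (- kr) p ->
  exists c1 c2, forall i, (i < K + 5)%N -> p i = c1 * broom_v1 i + c2 * broom_v2 i.
Proof.
move=> /unrows [[hl hl'] [hy hy'] _ hK hj].
have p0 : p 0%N = - p 1%N by apply: cancel_kr; lra.
have pl : p K.+3 = - p 1%N by apply: cancel_kr; lra.
have pK : p K.+1 = 0 by apply: cancel_kr; lra.
have inn : forall t j, (j + t = K.-1)%N ->
    p j.+1 = t.+1%:R * p K /\ p j.+2 = t%:R * p K.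
  elim=> [|t IH] j jt.
    have -> : j = K.-1 by lia.
    by rewrite prednK // pK mul0r mul1r.
  have [e1 e2] := IH j.+1 ltac:(lia); split => //.
  have jK : (j.+1 < K)%N by lia.
  have := hj j jK; rewrite e1 e2 => h.
  have w0 := broom_weight_gt0 (ltnW jK); apply: (mulfI (lt0r_neq0 w0)).
  have krE : kr = j%:R + t%:R + 2.
    rewrite /kr (_ : K = j + t + 2)%N; last by lia.
    by rewrite !natrD.
  move: h; rewrite weightS -!natr1 => h.
  have -> : broom_weight j * p j.+1 = - kr * ((t%:R + 1) * p K)
     - (-2 * broom_weight j - (j%:R + 1 + 1) * (kr - (j%:R + 1))) * ((t%:R + 1) * p K)
     - (broom_weight j + (j%:R + 1) * (kr - (j%:R + 1))) * (t%:R * p K) by lra.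
  by rewrite krE; ring.
have inn' i : (i <= K)%N -> p i.+1 = (kr - i%:R) * p K.
  rewrite leq_eqVlt => /orP[/eqP ->|iK]; first by rewrite pK -/kr; ring.
  have [-> _] := inn (K.-1 - i)%N i ltac:(lia); congr (_ * _).
  rewrite /kr (_ : K = (K.-1 - i).+1 + i)%N; last by lia.
  by rewrite natrD addrK; congr (_%:R); lia.
exists (- p K.+4), (p K).
have py : p K.+2 = - p K.+4 - broom_weight K.-1 / kr * p K.
  apply: cancel_kr.
  have -> : kr * (- p K.+4 - broom_weight K.-1 / kr * p K) =
    - kr * p K.+4 - broom_weight K.-1 * p K by field.
  move: hK; rewrite pK; lra.
have [[_ _ o1 o1'] [[_ _ o2 o2'] [_ _ o3 o3']]] := outer.
have [_ _ z z'] := at0.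
have p1 : p 1%N = kr * p K by rewrite inn' // subr0.
move=> [|i] iK; first by rewrite z z' p0 p1; ring.
have [iK'|] := leqP i K; first by have [_ _ -> ->] := inner iK'; rewrite inn' //; ring.
rewrite leq_eqVlt => /orP[/eqP <-|]; first by rewrite o1 o1' py; ring.
rewrite leq_eqVlt => /orP[/eqP <-|Ki]; first by rewrite o2 o2' pl p1; ring.
have -> : i.+1 = K.+4 by lia.
by rewrite o3 o3'; ring.
Qed.

(** The diagonal entries alone suffice. Vertices 1 and [K.+1], where one eigenspace vanishes,
    isolate [z3] and [y3]; the four leaves then give the remaining coefficients. *)
Lemma broom_stable : two_stable_double_eigenvalues (K + 5) broom.
Proof.
exists 0, (- kr), broom_u1, broom_u2, broom_v1, broom_v2; split.
- by rewrite eq_sym oppr_eq0.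
- by split; [exact: eig_u1 | exact: eig_u2 | exact: span_u].
- by split; [exact: eig_v1 | exact: eig_v2 | exact: span_v].
move=> y1 y2 y3 z1 z2 z3 e.
have diag i : (i < K + 5)%N -> quad_entry broom_u1 broom_u2 y1 y2 y3 i i +
    quad_entry broom_v1 broom_v2 z1 z2 z3 i i = 0.
  by move=> iK; apply: e; rewrite ?eqxx.
have [[o1 o1' o1'' o1'''] [[o2 o2' o2'' o2'''] [o3 o3' o3'' o3''']]] := outer.
have [i1 i1' i1'' i1'''] := inner (leq0n K).
have [iK iK' iK'' iK'''] := inner (leqnn K).
have sq0 (x y : R) : x != 0 -> y * (x * x) = 0 -> y = 0.
  by move=> x0 /eqP; rewrite mulrA !mulf_eq0 (negbTE x0) !orbF => /eqP.
have w0 : - broom_weight K.-1 / kr != 0.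
  by rewrite mulf_neq0 ?invr_neq0 // oppr_eq0 gt_eqF // broom_weight_gt0 //; lia.
have z30 : z3 = 0.
  apply: (sq0 kr) => //; have := diag 1%N ltac:(lia).
  by rewrite /quad_entry i1 i1' i1'' i1''' => h; rewrite -[RHS]h; ring.
have y30 : y3 = 0.
  apply: (sq0 kr) => //; have := diag K.+1 ltac:(lia).
  by rewrite /quad_entry iK iK' iK'' iK''' -/kr => h; rewrite -[RHS]h; ring.
have y10 : y1 = 0.
  have := diag K.+3 ltac:(lia); rewrite /quad_entry o2 o2' o2'' o2''' z30 => h.
  by rewrite -[RHS]h; ring.
have z10 : z1 = 0.
  have := diag K.+4 ltac:(lia); rewrite /quad_entry o3 o3' o3'' o3''' y30 => h.
  by rewrite -[RHS]h; ring.
have y20 : y2 = 0.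
  have [z z' z'' z'''] := at0.
  have := diag 0%N ltac:(lia); rewrite /quad_entry z z' z'' z''' y10 y30 z30 => h; lra.
have z20 : z2 = 0.
  apply: (mulIf w0); rewrite mul0r; have := diag K.+2 ltac:(lia).
  rewrite /quad_entry o1 o1' o1'' o1''' y30 z10 z30; move: (_ / kr) => w h; lra.
by [].
Qed.

Lemma broom_edgeP i j : (i < j)%N -> broom i j != 0 -> broom_support i j.
Proof.
move=> ij; rewrite /broom; have -> : (i == j) = false by lia.
case: (boolP (broom_support i j)) => // _.
case: (boolP (broom_support j i)) => [|_]; last by rewrite eqxx.
by rewrite /broom_support; lia.
Qed.
End DoubleBroom.

(** * Configurations excluded from G *)

Section ForbiddenConfigurations.
Variables (R : realType) (n : nat) (G : rel 'I_n).
Hypothesis simpleG : simple_graph G.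
Hypothesis qG : q_graph_ge R G n.-1.

Let symG : symmetric G. Proof. by case: simpleG. Qed.
Let irrG : irreflexive G. Proof. by case: simpleG. Qed.

Lemma no_long_cycle (s : seq 'I_n) : uniq s -> (3 < size s)%N -> ~~ cycle G s.
Proof.
move=> us ss; apply/negP; case: s us ss => // x s us ss cyc.
apply: (forbidden_subgraph (x0 := x) simpleG qG us erefl _ (twisted_cycle_stable R ss)).
  by move=> i j _ _; exact: twisted_cycle_sym.
have edge i : (i < size s)%N -> G (nth x (x :: s) i) (nth x (x :: s) i.+1).
  move=> ik; move: cyc => /= /(pathP x) /(_ i); rewrite size_rcons => /(_ (ltnW ik)).
  by rewrite nth_rcons ik -rcons_cons nth_rcons /= ltnS (ltnW ik).
have last : G (nth x (x :: s) (size s)) (nth x (x :: s) 0).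
  move: cyc => /= /(pathP x) /(_ (size s)); rewrite size_rcons => /(_ (leqnn _)).
  by rewrite nth_rcons ltnn eqxx -rcons_cons nth_rcons /= ltnSn.
move=> i j; rewrite /= ltnS => iK; rewrite ltnS => jK ij.
rewrite /twisted_cycle /=; case: ifP => [/orP[]/eqP e _|].
- by rewrite e; apply: edge; rewrite -e.
- by rewrite e symG; apply: edge; rewrite -e.
move=> _; case: ifP => [|_]; last by rewrite eqxx.
by move=> /orP[]/andP[/eqP -> /eqP ->] _ //; rewrite symG.
Qed.

Lemma no_cricket (c a1 a2 a3 a4 : 'I_n) : uniq [:: c; a1; a2; a3; a4] ->
  G c a1 -> G c a2 -> G c a3 -> G c a4 -> ~~ G a1 a2.
Proof.
move=> us g1 g2 g3 g4; apply/negP => g12.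
apply: (forbidden_subgraph (x0 := c) simpleG qG us erefl _ (cricket_stable R)).
  by move=> [|[|[|[|[|i]]]]] [|[|[|[|[|j]]]]].
by move=> [|[|[|[|[|i]]]]] [|[|[|[|[|j]]]]] //= _ _ _; rewrite /cricket_table /table /= ?eqxx //;
  rewrite symG.
Qed.

Lemma no_spider (c a1 a2 a3 b1 b2 b3 : 'I_n) : uniq [:: c; a1; a2; a3; b1; b2; b3] ->
  G c a1 -> G c a2 -> G c a3 -> G a1 b1 -> G a2 b2 -> ~~ G a3 b3.
Proof.
move=> us g1 g2 g3 h1 h2; apply/negP => h3.
apply: (forbidden_subgraph (x0 := c) simpleG qG us erefl _ (spider_stable R)).
  by move=> [|[|[|[|[|[|[|i]]]]]]] [|[|[|[|[|[|[|j]]]]]]].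
by move=> [|[|[|[|[|[|[|i]]]]]]] [|[|[|[|[|[|[|j]]]]]]] //= _ _ _;
  rewrite /spider_table /table /= ?eqxx //; rewrite symG.
Qed.

Lemma no_net (a1 a2 a3 b1 b2 b3 : 'I_n) : uniq [:: a1; a2; a3; b1; b2; b3] ->
  G a1 a2 -> G a2 a3 -> G a1 a3 -> G a1 b1 -> G a2 b2 -> ~~ G a3 b3.
Proof.
move=> us g1 g2 g3 h1 h2; apply/negP => h3.
apply: (forbidden_subgraph (x0 := a1) simpleG qG us erefl _ (net_stable R)).
  by move=> [|[|[|[|[|[|i]]]]]] [|[|[|[|[|[|j]]]]]].
by move=> [|[|[|[|[|[|i]]]]]] [|[|[|[|[|[|j]]]]]] //= _ _ _;
  rewrite /net_table /table /= ?eqxx //; rewrite symG.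
Qed.

Lemma no_double_broom (x0 : 'I_n) (p : seq 'I_n) (K : nat) (w w' : 'I_n) : (0 < K)%N ->
  size p = K.+3 -> sorted G p -> uniq (p ++ [:: w; w']) ->
  G (nth x0 p 1) w -> ~~ G (nth x0 p K.+1) w'.
Proof.
move=> K0 sp pG us gw; apply/negP => gw'.
have sz : size (p ++ [:: w; w']) = (K + 5)%N by rewrite size_cat sp /=; lia.
apply: (forbidden_subgraph (x0 := x0) simpleG qG us sz _ (broom_stable R K0)).
  by move=> i j _ _; exact: broom_sym.
set s := p ++ _.
suff lt i j : (i < j)%N -> broom R K i j != 0 -> G (nth x0 s i) (nth x0 s j).
  move=> i j _ _ ij b; case: (ltngtP i j) ij => // ij _; first exact: lt.
  by rewrite symG; apply: lt => //; rewrite broom_sym.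
move=> ij /(broom_edgeP K0 ij); rewrite /s !nth_cat sp => /or3P[].
- move=> /andP[/eqP -> jK].
  have i1 : (i.+1 < K.+3)%N by [].
  by rewrite i1 (ltnW i1); move/(sortedP x0): pG; apply; rewrite sp.
- by move=> /andP[/eqP -> /eqP ->]; rewrite ltnn subnn.
- move=> /andP[/eqP -> /eqP ->].
  have h1 : (K.+1 < K.+3)%N by rewrite !ltnS.
  have h2 : (K.+4 < K.+3)%N = false by rewrite ltnNge leqnSn.
  by rewrite h1 h2 subSnn.
Qed.

Let avoid c : rel 'I_n := [rel x y | [&& G x y, x != c & y != c]].

Lemma no_four_branches (c : 'I_n) (a : 'I_4 -> 'I_n) :
  (forall i, G c (a i)) ->
  (forall i j, i != j -> ~~ connect (avoid c) (a i) (a j)) -> False.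
Proof.
move=> ca sep; pose e := avoid c.
have esym : connect_sym e.
  by apply: sym_connect_sym => x y; rewrite /e /avoid /= symG [(x != c) && _]andbC.
pose w i x : R := (connect e (a i) x)%:R.
have ac i : a i != c.
  by apply/eqP => aic; have := ca i; rewrite aic irrG.
have wc i : w i c = 0.
  rewrite /w; suff -> : connect e (a i) c = false by [].
  have clo : closed_mem e (mem [pred x | x != c]).
    by move=> x y /and3P[_ xc yc]; rewrite !inE xc yc.
  apply/negP => /(closed_connect clo); rewrite !inE eqxx /= => h.
  by move: (ac i); rewrite h.
have we i x y : e x y -> w i x = w i y.
  move=> exy; rewrite /w; congr (_%:R); congr nat_of_bool.
  by apply/idP/idP => h; apply: connect_trans h (connect1 _) => //;
    move: exy; rewrite /e /avoid /= symG => /and3P[-> -> ->].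
(* [A] is the opposite of the Laplacian of [G - c], bordered by the edges at [c]; so
   [A w i] vanishes off [c]. *)
pose A : 'M[R]_n := \matrix_(x, y)
  (if x == y then (if x == c then 0 else - \sum_z (e x z)%:R) else (G x y)%:R).
have SGA : in_SG G A.
  split; first by apply/matrixP => x y; rewrite !mxE eq_sym symG; case: eqP => [->|].
  by move=> x y xy; rewrite mxE (negbTE xy); case: (G x y); rewrite ?oner_neq0 ?eqxx.
pose m i : R := \sum_z (G c z)%:R * w i z.
have m0 i : m i != 0.
  rewrite gt_eqF // /m (bigD1 (a i)) //= ca mul1r /w connect0 ltr_pwDl //.
  by apply: sumr_ge0 => z _; rewrite mulr_ge0.
have Aw i x : \sum_y A x y * w i y = if x == c then m i else 0.
  rewrite (bigD1 x) //= mxE eqxx.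
  have -> : \sum_(y | y != x) A x y * w i y = \sum_y (G x y)%:R * w i y.
    rewrite [RHS](bigD1 x) //= irrG mul0r add0r; apply: eq_bigr => y yx.
    by rewrite mxE eq_sym (negbTE yx).
  have [->|xc] := eqVneq x c; first by rewrite mul0r add0r.
  have -> : \sum_y (G x y)%:R * w i y = (\sum_z (e x z)%:R) * w i x.
    rewrite mulr_suml; apply: eq_bigr => y _.
    have [->|yc] := eqVneq y c; first by rewrite wc /e /avoid /= eqxx !andbF mulr0 mul0r.
    have -> : e x y = G x y by rewrite /e /avoid /= xc yc !andbT.
    case Gxy: (G x y); last by rewrite !mul0r.
    by rewrite !mul1r (we i x y) // /e /avoid /= Gxy xc yc.
  by rewrite mulNr addNr.
have waa i j : w i (a j) = (i == j)%:R.
  rewrite /w; have [->|ij] := eqVneq i j; first by rewrite connect0.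
  by rewrite (negbTE (sep _ _ ij)).
pose f (t : 'I_3) : 'I_4 := lift ord_max t.
(* [A w_i] equals [m i] at [c] and zero elsewhere, so these combinations lie in the kernel. Their
   values at the vertices [a (f t)] show that they are independent. *)
pose W : 'M[R]_(n, 3) := \matrix_(x, t) (m ord_max * w (f t) x - m (f t) * w ord_max x).
have rk : (2 < \rank (eigenspace A 0))%N.
  apply: (@rank_eigenspace_ge R n 3 3 A W 0 id) => //; first by case: SGA.
    move=> t; rewrite scale0r; apply/matrixP => x z; rewrite !mxE.
    transitivity (m ord_max * (\sum_y A x y * w (f t) y) - m (f t) * \sum_y A x y * w ord_max y).
      rewrite !mulr_sumr -sumrB; apply: eq_bigr => y _.
      have -> : col t W y z = m ord_max * w (f t) y - m (f t) * w ord_max y by rewrite !mxE.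
      by ring.
    by rewrite !Aw; case: ifP => _; ring.
  move=> x _ Wx; apply/matrixP => t z; rewrite [z]ord1 [RHS]mxE.
  have := congr1 (fun X : 'cV_n => X (a (f t)) 0) Wx; rewrite !mxE.
  rewrite (bigD1 t) //= big1 => [|s st].
    rewrite addr0 mxE !waa eqxx mulr1.
    have -> : (ord_max == f t) = false by apply/negbTE; exact: neq_lift.
    by rewrite mulr0 subr0 => /eqP; rewrite mulf_eq0 (negbTE (m0 _)) => /eqP.
  rewrite mxE !waa; have -> : (ord_max == f t) = false by apply/negbTE; exact: neq_lift.
  by rewrite (inj_eq (@lift_inj _ _)) (negbTE st) !mulr0 subr0 mul0r.
by apply: (no_two_defects qG SGA (x := 0) (y := 0)); rewrite eqxx.
Qed.

(** Two neighbours of [c] are not adjacent, since the other two would complete a cricket. A simple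
    path between them that avoids [c] thus has an inner vertex and closes through [c] to a cycle of
    length at least 4. *)
Lemma no_degree_four (c a1 a2 a3 a4 : 'I_n) : uniq [:: a1; a2; a3; a4] ->
  G c a1 -> G c a2 -> G c a3 -> ~~ G c a4.
Proof.
move=> ua g1 g2 g3; apply/negP => g4.
pose s := [:: a1; a2; a3; a4]; pose a (i : 'I_4) := nth c s i.
have ca i : G c (a i) by case: i => [] [|[|[|[|//]]]].
have a_inj : injective a.
  by move=> i j /eqP; rewrite nth_uniq // => /eqP; exact: val_inj.
have nadj i j : i != j -> ~~ G (a i) (a j).
  move=> ij.
  have [k [l [ki kj li lj kl]]] : exists k l, [/\ k != i, k != j, l != i, l != j & k != l].
    have : (1 < #|~: [set i; j]|)%N.
      by have := cardsC [set i; j]; rewrite cards2 ij card_ord; lia.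
    move=> /card_gt1P[k [l [+ + kl]]]; rewrite !inE !negb_or => /andP[? ?] /andP[? ?].
    by exists k, l.
  apply: (@no_cricket c (a i) (a j) (a k) (a l)) => //.
  have nc t : c != a t by apply/eqP => e; have := ca t; rewrite -e irrG.
  rewrite /= !inE !negb_or !nc !(inj_eq a_inj) ij kl /=.
  by rewrite ![i == _]eq_sym ![j == _]eq_sym ki kj li lj.
apply: (no_four_branches ca) => i j ij; apply/negP => /connectP[p pp lp].
case/shortenP: pp lp => p' pp' up' _ lp'.
have cp' : c \notin a i :: p'.
  rewrite inE negb_or; apply/andP; split.
    by apply/eqP => e; have := ca i; rewrite -e irrG.
  apply/negP => cp; have := pp'; case/splitPr: cp => q1 q2.
  by rewrite cat_path /= => /andP[_ /andP[/and3P[_ _]]]; rewrite eqxx.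
have pG : path G (a i) p' by apply: sub_path pp' => x y /and3P[].
case: p' pp' up' lp' cp' pG => [|x [|y q]] pp' up' lp' cp' pG.
- by move: ij; rewrite -(inj_eq a_inj) -[a i]lp' eqxx.
- by move: (nadj i j ij); rewrite lp' /=; move: pG; rewrite /= andbT => ->.
have := @no_long_cycle (c :: a i :: x :: y :: q).
rewrite cons_uniq cp' up' => /(_ isT isT).
rewrite /cycle rcons_path; move: pG lp'; rewrite /= => -> <-.
by rewrite ca symG ca.
Qed.
End ForbiddenConfigurations.

(** * The strong spectral property for paths with a chord or a pendant vertex *)

Section Forcing.
Variables (R : realType) (n : nat) (G : rel 'I_n) (A X : 'M[R]_n).
Hypothesis simpleG : simple_graph G.
Hypothesis SGA : in_SG G A.
Hypothesis symX : X^T = X.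
Hypothesis AX0 : forall i j, A i j * X i j = 0.
Hypothesis X_diag : forall i, X i i = 0.
Hypothesis AXC : A *m X = X *m A.

Let symG : symmetric G. Proof. by case: simpleG. Qed.
Let irrG : irreflexive G. Proof. by case: simpleG. Qed.

Let Xsym x y : X x y = X y x. Proof. by rewrite -{1}symX mxE. Qed.
Let Asym x y : A x y = A y x. Proof. by case: SGA => sA _; rewrite -{1}sA mxE. Qed.

Let A_edge x y : G x y -> A x y != 0.
Proof.
move=> g; have xy : x != y by apply/eqP => e; move: g; rewrite e irrG.
by case: SGA => _ /(_ x y xy) ->.
Qed.

Let A_nonedge x y : x != y -> ~~ G x y -> A x y = 0.
Proof. by move=> xy; case: SGA => _ /(_ x y xy) <- /negPn /eqP. Qed.

Let X_edge x y : G x y -> X x y = 0.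
Proof.
by move=> /A_edge a; apply/eqP; have /eqP := AX0 x y; rewrite mulf_eq0 (negbTE a).
Qed.

(** The vertex [x] itself is included because the diagonal of [A] is arbitrary. *)
Definition near (x z : 'I_n) : bool := (z == x) || G x z.

Let off_near x z y : ~~ near x z -> A x z * X z y = 0.
Proof.
by rewrite negb_or => /andP[zx g]; rewrite A_nonedge ?mul0r // eq_sym.
Qed.

(** In the entry [(x, y)] of [A X = X A], only [z] near [x] contributes on the left and only [z]
    near [y] on the right. *)
Lemma commutator_pair x y z0 z1 : z0 != z1 ->
  (forall z, near x z -> z != z0 -> z != z1 -> X z y = 0) ->
  (forall z, near y z -> X x z = 0) ->
  A x z0 * X z0 y + A x z1 * X z1 y = 0.
Proof.
move=> z01 hx hy; have := congr1 (fun Y : 'M_n => Y x y) AXC; rewrite !mxE.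
rewrite [RHS]big1 => [|z _]; last first.
  have [/hy ->|nz] := boolP (near y z); first by rewrite mul0r.
  by rewrite mulrC Asym Xsym off_near.
rewrite (bigD1 z0) //= (bigD1 z1) 1?eq_sym //= big1 ?addr0 // => z /andP[zz0 zz1].
have [nz|nz] := boolP (near x z); last exact: off_near.
by rewrite (hx _ nz) ?mulr0.
Qed.

(** The second term of [commutator_pair] is taken at [x] itself, where [X x y = 0] because [y] is
    near [y]. *)
Lemma forcing x y z0 : G x z0 ->
  (forall z, near x z -> z != z0 -> X z y = 0) ->
  (forall z, near y z -> X x z = 0) -> X z0 y = 0.
Proof.
move=> g hx hy; have xz : z0 != x by apply/eqP => e; move: g; rewrite e irrG.
have := @commutator_pair x y z0 x xz.
have Xxy : X x y = 0 by apply: hy; rewrite /near eqxx.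
rewrite Xxy mulr0 addr0 => e.
have /eqP : A x z0 * X z0 y = 0 by apply: e => // z nz zz0 _; exact: hx.
by rewrite mulf_eq0 (negbTE (A_edge g)) => /eqP.
Qed.

Section Chain.
Variables (v : nat -> 'I_n) (m : nat).
Hypothesis v_inj : forall r s, (r < m)%N -> (s < m)%N -> v r = v s -> r = s.

Let Z r s := X (v r) (v s).
Let Zsym r s : Z r s = Z s r. Proof. exact: Xsym. Qed.

Section Spanning.
Hypothesis v_span : forall z, exists2 k, (k < m)%N & z = v k.

Let forceN r k s : (r < m)%N -> (k < m)%N -> (s < m)%N -> G (v r) (v k) ->
  (forall t, (t < m)%N -> (t == r) || G (v r) (v t) -> t != k -> Z t s = 0) ->
  (forall t, (t < m)%N -> (t == s) || G (v s) (v t) -> Z r t = 0) -> Z k s = 0.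
Proof.
move=> rm km sm g h1 h2; apply: (forcing g) => z; have [t tm ->] := v_span z.
  rewrite /near => nz tk; apply: h1 => //; last by apply: contraNneq tk => ->.
  by case/orP: nz => [/eqP /v_inj -> //|->]; rewrite ?eqxx ?orbT.
rewrite /near => nz; apply: h2 => //.
by case/orP: nz => [/eqP /v_inj -> //|->]; rewrite ?eqxx ?orbT.
Qed.

Let X0_of_Z : (forall r s, (r < m)%N -> (s < m)%N -> Z r s = 0) -> X = 0.
Proof.
move=> Z0; apply/matrixP => x y; rewrite mxE.
by have [r rm ->] := v_span x; have [s sm ->] := v_span y; exact: Z0.
Qed.

Let banded d := forall r s, (r < m)%N -> (s < m)%N -> (r <= s + d)%N -> (s <= r + d)%N -> Z r s = 0.

Let banded_step d :
  banded d -> (forall r, (r + d.+1 < m)%N -> Z r (r + d.+1) = 0) -> banded d.+1.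
Proof.
move=> bd h r s rm sm rs sr.
have [e|] := eqVneq r (s + d.+1)%N; first by rewrite Zsym e h -?e.
have [e|ne1 ne2] := eqVneq s (r + d.+1)%N; first by rewrite e h -?e.
by apply: bd => //; lia.
Qed.

Let banded_full : (forall d, banded d.+1) -> X = 0.
Proof. by move=> h; apply: X0_of_Z => r s rm sm; apply: (h m) => //; lia. Qed.

(** Once [X] vanishes up to distance [D], the commutator entry [(r + D, r)] involves only the
    entries [(r + D + 1, r)] and [(r + D, r - 1)] of the next distance. The second is absent at
    [r = 0], so the whole diagonal is filled from the left end. *)
Lemma path_SSP : (forall r s, (r < m)%N -> (s < m)%N ->
    G (v r) (v s) = (s == r.+1) || (r == s.+1)) -> X = 0.
Proof.
move=> Gv; apply: banded_full; elim=> [|d IH].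
  move=> r s rm sm rs sr; have [->|ne] := eqVneq r s; first exact: X_diag.
  by apply: X_edge; rewrite Gv //; lia.
apply: banded_step => // r; elim: r => [|r IHr] rm; rewrite Zsym.
  apply: (@forceN d.+1 (0 + d.+2) 0); [lia|lia|lia|by rewrite Gv; lia| |].
  - by move=> t tm; rewrite Gv; [move=> h1 h2; apply: IH; lia | lia | lia].
  - by move=> t tm; rewrite Gv; [move=> h1; apply: IH; lia | lia | lia].
apply: (@forceN (r.+1 + d.+1) (r.+1 + d.+2) r.+1); [lia|lia|lia|by rewrite Gv; lia| |].
- by move=> t tm; rewrite Gv; [move=> h1 h2; apply: IH; lia | lia | lia].
- move=> t tm; rewrite Gv; [move=> h1|lia|lia].
  have [->|tr] := eqVneq t r; last by apply: IH; lia.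
  by rewrite Zsym (_ : r.+1 + d.+1 = r + d.+2)%N ?IHr //; lia.
Qed.

Lemma chord_SSP i : (i.+2 < m)%N -> (forall r s, (r < m)%N -> (s < m)%N ->
    G (v r) (v s) = [|| s == r.+1, r == s.+1, (r == i) && (s == i.+2) |
                        (s == i) && (r == i.+2)]) -> X = 0.
Proof.
move=> im Gv.
(* At the two entries [E1], [E2] the chord shortcuts a distance [d + 1] of the path
   to [d]; they have to be carried along with the band in the induction. *)
pose E1 d := forall r, (r + d = i.+1)%N -> Z r i.+2 = 0.
pose E2 d := (i + d.+1 < m)%N -> Z i (i + d.+1) = 0.
have H d : [/\ banded d.+1, E1 d.+1 & E2 d.+1].
  elim: d => [|d [IH e1 e2]].
    have edge0 r s : (r < m)%N -> (s < m)%N -> G (v r) (v s) -> Z r s = 0.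
      by move=> _ _; exact: X_edge.
    split.
    - move=> r s rm sm rs sr; have [->|ne] := eqVneq r s; first exact: X_diag.
      by apply: edge0 => //; rewrite Gv //; lia.
    - by move=> r ri; apply: edge0; [lia|lia|rewrite Gv; lia].
    - by move=> h; apply: edge0; [lia|lia|rewrite Gv; lia].
  pose D := d.+1.
  have left r : (r + D < i)%N -> Z r (r + D.+1) = 0.
    elim: r => [|r IHr] rm; rewrite Zsym.
      apply: (@forceN D (0 + D.+1) 0); [lia|lia|lia|by rewrite Gv; lia| |].
      - by move=> t tm; rewrite Gv; [move=> h1 h2; apply: IH; lia | lia | lia].
      - by move=> t tm; rewrite Gv; [move=> h1; apply: IH; lia | lia | lia].
    apply: (@forceN (r.+1 + D) (r.+1 + D.+1) r.+1); [lia|lia|lia|by rewrite Gv; lia| |].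
    - by move=> t tm; rewrite Gv; [move=> h1 h2; apply: IH; lia | lia | lia].
    - move=> t tm; rewrite Gv; [move=> h1|lia|lia].
      have [->|tr] := eqVneq t r; last by apply: IH; lia.
      by rewrite Zsym (_ : r.+1 + D = r + D.+1)%N ?IHr //; lia.
  (* The run of entries across the chord starts at the left end, or at [r + D = i + 1], where the
     entry is an instance of [E1]. *)
  have mid r : (r <= i.+1)%N -> (i.+1 <= r + D)%N -> (r + D.+1 < m)%N -> Z r (r + D.+1) = 0.
    elim: r => [|r IHr] r1 r2 rm.
      have [e|ne] := eqVneq D i.+1; first by rewrite add0n e; apply: e1; rewrite -/D e.
      rewrite Zsym; apply: (@forceN D (0 + D.+1) 0); [lia|lia|lia|by rewrite Gv; lia| |].
      - by move=> t tm; rewrite Gv; [move=> h1 h2; apply: IH; lia | lia | lia].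
      - by move=> t tm; rewrite Gv; [move=> h1; apply: IH; lia | lia | lia].
    have [e|ne] := eqVneq (r.+1 + D)%N i.+1.
      by rewrite addnS e; apply: e1; exact: e.
    rewrite Zsym; apply: (@forceN (r.+1 + D) (r.+1 + D.+1) r.+1); [lia|lia|lia|by rewrite Gv; lia| |].
    - by move=> t tm; rewrite Gv; [move=> h1 h2; apply: IH; lia | lia | lia].
    - move=> t tm; rewrite Gv; [move=> h1|lia|lia].
      have [->|tr] := eqVneq t r; last by apply: IH; lia.
      by rewrite Zsym (_ : r.+1 + D = r + D.+1)%N ?IHr //; lia.
  (* At [r = i + 2] the previous step would meet the chord back to [i], at the unknown distance
     [D + 2]. The band is therefore filled from the right end, and [k] counts the entries left
     there. *)
  have right k r : (k + r + D.+2 = m)%N -> (i.+2 <= r)%N -> Z r (r + D.+1) = 0.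
    elim: k r => [|k IHk] r rm ri.
      apply: (@forceN r.+1 r (r + D.+1)); [lia|lia|lia|by rewrite Gv; lia| |].
      - by move=> t tm; rewrite Gv; [move=> h1 h2; apply: IH; lia | lia | lia].
      - by move=> t tm; rewrite Gv; [move=> h1; apply: IH; lia | lia | lia].
    apply: (@forceN r.+1 r (r + D.+1)); [lia|lia|lia|by rewrite Gv; lia| |].
    - by move=> t tm; rewrite Gv; [move=> h1 h2; apply: IH; lia | lia | lia].
    - move=> t tm; rewrite Gv; [move=> h1|lia|lia].
      have [->|tr] := eqVneq t (r.+1 + D.+1)%N; last by apply: IH; lia.
      by apply: IHk; lia.
  have right' r : (i.+2 <= r)%N -> (r + D.+1 < m)%N -> Z r (r + D.+1) = 0.
    by move=> ri rm; apply: (right (m - (r + D.+2))%N) => //; lia.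
  (* The commutator entry [(i, r)] would reach [i + 2] through the chord, at distance [D + 2]. The
     entry [(r + 1, i + 1)] is used instead; its extra term is an instance of [E1]. *)
  have corner r : (r + D = i)%N -> Z r (r + D.+1) = 0.
    move=> ri; apply: (@forceN r.+1 r (r + D.+1)); [lia|lia|lia|by rewrite Gv; lia| |].
    - by move=> t tm; rewrite Gv; [move=> h1 h2; apply: IH; lia | lia | lia].
    - move=> t tm; rewrite Gv; [move=> h1|lia|lia].
      have [->|tr] := eqVneq t i.+2; last by apply: IH; lia.
      by apply: e1; lia.
  have bd : banded D.+1.
    apply: banded_step => // r rm.
    have [h|h] := ltnP (r + D) i; first exact: left.
    have [h2|h2] := eqVneq (r + D)%N i; first exact: corner.
    by have [h3|h3] := ltnP r i.+2; [apply: mid => //; lia | exact: right'].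
  split=> //.
  - move=> r ri; rewrite Zsym; apply: (@forceN i i.+2 r); [lia|lia|lia|by rewrite Gv; lia| |].
    + by move=> t tm; rewrite Gv; [move=> h1 h2; apply: bd; lia | lia | lia].
    + by move=> t tm; rewrite Gv; [move=> h1; apply: bd; lia | lia | lia].
  - move=> hm; apply: (@forceN i.+2 i (i + D.+2)); [lia|lia|lia|by rewrite Gv; lia| |].
    + by move=> t tm; rewrite Gv; [move=> h1 h2; apply: bd; lia | lia | lia].
    + by move=> t tm; rewrite Gv; [move=> h1; apply: bd; lia | lia | lia].
by apply: banded_full => d; case: (H d).
Qed.
End Spanning.

Lemma pendant_SSP w i : (0 < i)%N -> (i.+1 < m)%N ->
  (forall z, z = w \/ exists2 k, (k < m)%N & z = v k) ->
  (forall k, (k < m)%N -> w != v k) ->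
  (forall r s, (r < m)%N -> (s < m)%N -> G (v r) (v s) = (s == r.+1) || (r == s.+1)) ->
  (forall s, (s < m)%N -> G w (v s) = (s == i)) -> X = 0.
Proof.
move=> i0 im span wv Gv Gw.
pose Zw s := X w (v s).
have force x y z0 : G x z0 -> (near x w -> w != z0 -> X w y = 0) ->
    (forall t, (t < m)%N -> near x (v t) -> v t != z0 -> X (v t) y = 0) ->
    (near y w -> X x w = 0) ->
    (forall t, (t < m)%N -> near y (v t) -> X x (v t) = 0) -> X z0 y = 0.
  move=> g h1 h2 h3 h4; apply: (forcing g) => z.
    by case: (span z) => [->|[t tm ->]]; [exact: h1 | exact: h2].
  by case: (span z) => [->|[t tm ->]]; [exact: h3 | exact: h4].
have near_vv r t : (r < m)%N -> (t < m)%N -> near (v r) (v t) = (t <= r.+1)%N && (r <= t.+1)%N.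
  move=> rm tm; rewrite /near Gv //; have [->|ne] := eqVneq t r; first by rewrite eqxx; lia.
  have -> : (v t == v r) = false by apply/eqP => /v_inj e; move/eqP: ne; apply; exact: e.
  by lia.
have near_vw r : (r < m)%N -> near (v r) w = (r == i).
  by move=> rm; rewrite /near (negbTE (wv r rm)) symG Gw.
have near_wv r : (r < m)%N -> near w (v r) = (r == i).
  by move=> rm; rewrite /near eq_sym (negbTE (wv r rm)) Gw.
have neqv r t : (r < m)%N -> (t < m)%N -> v r != v t -> r != t.
  by move=> _ _; apply: contraNneq => ->.
have forceN r k s : (r < m)%N -> (k < m)%N -> (s < m)%N -> (k == r.+1) || (r == k.+1) ->
    (r = i -> Zw s = 0) -> (s = i -> Zw r = 0) ->
    (forall t, (t < m)%N -> (t <= r.+1)%N && (r <= t.+1)%N -> t != k -> Z t s = 0) ->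
    (forall t, (t < m)%N -> (t <= s.+1)%N && (s <= t.+1)%N -> Z r t = 0) -> Z k s = 0.
  move=> rm km sm g h1 h2 h3 h4; apply: (force (v r)).
  - by rewrite Gv.
  - by rewrite near_vw // => /eqP ri _; exact: h1.
  - by move=> t tm; rewrite near_vv // => nt /neqv tk; apply: h3 => //; exact: tk.
  - by rewrite near_vw // => /eqP si; rewrite Xsym; exact: h2.
  - by move=> t tm; rewrite near_vv // => nt; exact: h4.
have b1 r s : (r < m)%N -> (s < m)%N -> (r <= s.+1)%N -> (s <= r.+1)%N -> Z r s = 0.
  move=> rm sm rs sr; have [->|ne] := eqVneq r s; first exact: X_diag.
  by apply: X_edge; rewrite Gv //; lia.
(* Distance two is reached from the left end up to the branch vertex and from the right end beyond
   it. The entry between the two path neighbours of [v i] is left to the equations around [v i]. *)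
have left r : (r.+2 <= i)%N -> Z r r.+2 = 0.
  elim: r => [|r IHr] ri; rewrite Zsym.
    apply: (@forceN 1%N 2 0%N); [lia|lia|lia|lia|lia|lia| |].
    - by move=> t tm h1 h2; apply: b1; lia.
    - by move=> t tm h1; apply: b1; lia.
  apply: (@forceN r.+2 r.+3 r.+1); [lia|lia|lia|lia|lia|lia| |].
  - by move=> t tm h1 h2; apply: b1; lia.
  - move=> t tm h1; have [->|tr] := eqVneq t r; last by apply: b1; lia.
    by rewrite Zsym IHr //; lia.
have right k r : (k + r.+3 = m)%N -> (i <= r)%N -> Z r r.+2 = 0.
  elim: k r => [|k IHk] r rm ri.
    apply: (@forceN r.+1 r r.+2); [lia|lia|lia|lia|lia|lia| |].
    - by move=> t tm h1 h2; apply: b1; lia.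
    - by move=> t tm h1; apply: b1; lia.
  apply: (@forceN r.+1 r r.+2); [lia|lia|lia|lia|lia|lia| |].
  - by move=> t tm h1 h2; apply: b1; lia.
  - move=> t tm h1; have [->|tr] := eqVneq t r.+3; last by apply: b1; lia.
    by apply: IHk; lia.
have Zwi : Zw i = 0 by apply: X_edge; rewrite Gw; lia.
pose j := i.-1.
have ij : i = j.+1 by lia.
have claw b c d : G (v i) c -> G (v i) d -> c != d -> c != b -> d != b ->
    X (v i) b = 0 -> (forall z, near (v i) z -> [\/ z = v i, z = b, z = c | z = d]) ->
    (forall z, near b z -> X (v i) z = 0) ->
    A (v i) c * X c b + A (v i) d * X d b = 0.
  move=> gc gd cd cb db xb nz hb; apply: commutator_pair => // z /nz [->|->|->|->] zc zd.
  - exact: xb.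
  - exact: X_diag.
  - by rewrite eqxx in zc.
  - by rewrite eqxx in zd.
have v_neq r s : (r < m)%N -> (s < m)%N -> r != s -> v r != v s.
  by move=> rm sm; apply: contraNneq => e; apply/eqP; exact: v_inj.
have near_i z : near (v i) z -> [\/ z = v i, z = v j, z = v i.+1 | z = w].
  case: (span z) => [-> _|[t tm ->]]; first by constructor 4.
  rewrite near_vv //; last lia.
  move=> h; have : [\/ t = i, t = j | t = i.+1].
    have [/eqP|/eqP|/eqP] : [\/ t == i, t == j | t == i.+1] by apply/or3P; lia.
    + by constructor 1.
    + by constructor 2.
    + by constructor 3.
  by case=> ->; [constructor 1|constructor 2|constructor 3].
have jm : (j < m)%N by lia.
have imm : (i < m)%N by lia.
have gj : G (v i) (v j) by rewrite Gv //; lia.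
have g1 : G (v i) (v i.+1) by rewrite Gv //; lia.
have gw : G (v i) w by rewrite symG Gw.
have hj z : near (v j) z -> X (v i) z = 0.
  case: (span z) => [->|[t tm ->]]; first by rewrite near_vw //; lia.
  rewrite near_vv // => h; have [e|ne] := eqVneq j t.+1.
    rewrite -/(Z i t) Zsym (_ : i = t.+2) ?left //; lia.
  by apply: b1; lia.
have h1 z : near (v i.+1) z -> X (v i) z = 0.
  case: (span z) => [->|[t tm ->]]; first by rewrite near_vw //; lia.
  rewrite near_vv // => h; have [e|ne] := eqVneq t i.+2.
    by rewrite e; apply: (right (m - i.+3)%N); lia.
  by apply: b1; lia.
have hw z : near w z -> X (v i) z = 0.
  case: (span z) => [-> _|[t tm ->]]; first by rewrite Xsym.
  by rewrite near_wv // => /eqP ->; rewrite X_diag.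
(* Around [v i] the commutator gives three equations in the three unknown entries
   between its neighbours; their determinant is twice a product of edge weights. *)
have vij : v i.+1 != v j by apply: v_neq; lia.
have vji : v j != v i.+1 by rewrite eq_sym.
have e1 := claw (v j) (v i.+1) w g1 gw.
have e2 := claw (v i.+1) (v j) w gj gw.
have e3 := claw w (v j) (v i.+1) gj g1.
have nw k : (k < m)%N -> v k != w by move=> km; rewrite eq_sym wv.
have {}e1 : A (v i) (v i.+1) * Z i.+1 j + A (v i) w * Zw j = 0.
  apply: e1; [exact: nw|exact: vij|exact: wv|exact: X_edge| |exact: hj].
  by move=> z /near_i [->|->|->|->]; [constructor 1|constructor 2|constructor 3|constructor 4].
have {}e2 : A (v i) (v j) * Z j i.+1 + A (v i) w * Zw i.+1 = 0.
  apply: e2; [exact: nw|exact: vji|exact: wv|exact: X_edge| |exact: h1].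
  by move=> z /near_i [->|->|->|->]; [constructor 1|constructor 3|constructor 2|constructor 4].
have {}e3 : A (v i) (v j) * Zw j + A (v i) (v i.+1) * Zw i.+1 = 0.
  rewrite /Zw (Xsym w) (Xsym w); apply: e3; [exact: vji|exact: nw|exact: nw|exact: X_edge| |exact: hw].
  by move=> z /near_i [->|->|->|->]; [constructor 1|constructor 3|constructor 4|constructor 2].
have aj := A_edge gj; have a1 := A_edge g1; have aw := A_edge gw.
have Zwj : Zw j = 0.
  apply: (mulfI aj); apply: (mulfI aw); rewrite !mulr0.
  have : 2 * (A (v i) w * (A (v i) (v j) * Zw j)) =
      A (v i) w * (A (v i) (v j) * Zw j + A (v i) (v i.+1) * Zw i.+1) -
      A (v i) (v i.+1) * (A (v i) (v j) * Z j i.+1 + A (v i) w * Zw i.+1) +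
      A (v i) (v j) * (A (v i) (v i.+1) * Z i.+1 j + A (v i) w * Zw j).
    by rewrite [Z i.+1 j]Zsym; ring.
  rewrite e1 e2 e3; lra.
have Zj : Z j i.+1 = 0.
  by apply: (mulfI a1); move: e1; rewrite Zwj mulr0 addr0 Zsym mulr0.
have Zw1 : Zw i.+1 = 0.
  by apply: (mulfI aw); move: e2; rewrite Zj mulr0 add0r mulr0.
move=> {vij vji claw near_i hj h1 hw nw v_neq e1 e2 e3 aj a1 aw gj g1 gw}.
pose banded d := forall r s, (r < m)%N -> (s < m)%N ->
  (r <= s + d)%N -> (s <= r + d)%N -> Z r s = 0.
(* The distance from [w] to [v s] is [|s - i| + 1], so [bandw d] covers distances up to [d], just as
   [banded d] does on the path. *)
pose bandw d := forall s, (s < m)%N -> (s < i + d)%N -> (i < s + d)%N -> Zw s = 0.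
have bstep d : banded d -> (forall r, (r + d.+1 < m)%N -> Z r (r + d.+1) = 0) -> banded d.+1.
  move=> bd h r s rm sm rs sr.
  have [e|] := eqVneq r (s + d.+1)%N; first by rewrite Zsym e h -?e.
  have [e|ne1 ne2] := eqVneq s (r + d.+1)%N; first by rewrite e h -?e.
  by apply: bd => //; lia.
have H d : banded d.+2 /\ bandw d.+2.
  elim: d => [|d [IH IHw]].
    split.
      apply: bstep; first by move=> r s rm sm rs sr; apply: b1; lia.
      move=> r rm; rewrite addn2.
      have [h|h] := leqP r.+2 i; first exact: left.
      have [->|ne] := eqVneq r j; first by rewrite -ij.
      by apply: (right (m - r.+3)%N); lia.
    move=> s sm s1 s2.
    have [->//|ne] := eqVneq s i; have [->//|ne2] := eqVneq s j.
    by have -> : s = i.+1 by lia.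
  pose D := d.+2.
  have wstep s r : (s < m)%N -> (r < m)%N -> (r == s.+1) || (s == r.+1) -> r != i ->
      (r < i + D)%N -> (i < r + D)%N ->
      (forall t, (t < m)%N -> (t <= r.+1)%N && (r <= t.+1)%N -> t != s -> Zw t = 0) -> Zw s = 0.
    move=> sm rm rs ri r1 r2 hz; rewrite /Zw Xsym; apply: (force (v r)).
    - by rewrite Gv //; lia.
    - by rewrite near_vw // (negbTE ri).
    - by move=> t tm; rewrite near_vv // => h /neqv ts; rewrite Xsym; apply: hz => //; exact: ts.
    - by move=> _; rewrite Xsym; apply: IHw.
    - by move=> t tm; rewrite near_wv // => /eqP ->; apply: IH; lia.
  (* The row of [w] is advanced before the band: when the step along the path involves row or column
     [i], it meets the entries of [w] with [v (i + D)] or [v (i - D)]. *)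
  have bw : bandw D.+1.
    move=> s sm s1 s2; have [e|ne] := eqVneq s (i + D)%N.
      apply: (@wstep s s.-1); try lia.
      by move=> t tm h1' h2; apply: IHw; lia.
    have [e|ne2] := eqVneq i (s + D)%N.
      apply: (@wstep s s.+1); try lia.
      by move=> t tm h1' h2; apply: IHw; lia.
    by apply: IHw; lia.
  split=> //; apply: bstep => // r; elim: r => [|r IHr] rm; rewrite Zsym.
    apply: (@forceN D (0 + D.+1)%N 0%N); [lia|lia|lia|lia| | | |].
    - by move=> h; apply: bw; lia.
    - by lia.
    - by move=> t tm h1' h2; apply: IH; lia.
    - by move=> t tm h1'; apply: IH; lia.
  apply: (@forceN (r.+1 + D)%N (r.+1 + D.+1)%N r.+1); [lia|lia|lia|lia| | | |].
  - by move=> h; apply: bw; lia.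
  - by move=> h; apply: bw; lia.
  - by move=> t tm h1' h2; apply: IH; lia.
  - move=> t tm h1'; have [->|tr] := eqVneq t r; last by apply: IH; lia.
    by rewrite Zsym (_ : r.+1 + D = r + D.+1)%N ?IHr //; lia.
have Zall r s : (r < m)%N -> (s < m)%N -> Z r s = 0.
  by move=> rm sm; have [bd _] := H m; apply: bd; lia.
have Zwall s : (s < m)%N -> Zw s = 0.
  by move=> sm; have [_ bw] := H m; apply: bw; lia.
apply/matrixP => x y; rewrite mxE.
case: (span x) => [->|[r rm ->]]; case: (span y) => [->|[s sm ->]].
- exact: X_diag.
- exact: Zwall.
- by rewrite Xsym; exact: Zwall.
- exact: Zall.
Qed.
End Chain.
End Forcing.

Ltac nlia := repeat match goal with
  | H : is_true (?g _ _) |- _ =>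
      lazymatch type of g with rel (ordinal _) => clear H end
  | H : is_true (_ \notin _) |- _ => clear H
  | H : is_true (_ \in _) |- _ => clear H
  | H : is_true (uniq _) |- _ => clear H
  | H : is_true (sorted _ _) |- _ => clear H
  | H : forall _, _ |- _ => clear H
  end; lia.

(** * Structure along a longest path *)

Section LongestPath.
Variables (R : realType) (n : nat) (G : rel 'I_n).
Hypothesis simpleG : simple_graph G.
Hypothesis connG : connected_graph G.
Hypothesis qG : q_graph_ge R G n.-1.
Variables (x0 : 'I_n) (p : seq 'I_n).
Hypothesis uniq_p : uniq p.
Hypothesis sorted_p : sorted G p.
Hypothesis max_p : forall s, uniq s -> sorted G s -> (size s <= size p)%N.

Let symG : symmetric G. Proof. by case: simpleG. Qed.
Let irrG : irreflexive G. Proof. by case: simpleG. Qed.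

Let m := size p.
Let v k := nth x0 p k.
Let seg a l := [seq v k | k <- iota a l].

Let v_inj r s : (r < m)%N -> (s < m)%N -> v r = v s -> r = s.
Proof. by move=> rm sm /eqP; rewrite nth_uniq // => /eqP. Qed.

Let vE r s : (r < m)%N -> (s < m)%N -> (v r == v s) = (r == s).
Proof. by move=> rm sm; rewrite nth_uniq. Qed.

Let v_edge k : (k.+1 < m)%N -> G (v k) (v k.+1).
Proof. by move/(sortedP x0): sorted_p; apply. Qed.

Let seg_size a l : size (seg a l) = l. Proof. by rewrite size_map size_iota. Qed.

Let seg_nth a l k : (k < l)%N -> nth x0 (seg a l) k = v (a + k).
Proof. by move=> kl; rewrite (nth_map 0%N) ?size_iota // nth_iota. Qed.

Let seg_uniq a l : (a + l <= m)%N -> uniq (seg a l).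
Proof.
move=> al; rewrite map_inj_in_uniq ?iota_uniq // => r s.
by rewrite !mem_iota => hr hs; apply: v_inj; nlia.
Qed.

Let seg_notin a l x : (forall k, (a <= k < a + l)%N -> x != v k) -> x \notin seg a l.
Proof.
by move=> h; apply/negP => /mapP[k]; rewrite mem_iota => /h /eqP.
Qed.

Let seg_sorted a l : (a + l <= m)%N -> sorted G (seg a l).
Proof.
move=> al; apply/(sortedP x0) => k; rewrite seg_size => kl.
by rewrite !seg_nth ?(ltnW kl) // addnS; apply: v_edge; nlia.
Qed.

Let seg_path a l : (a + l < m)%N -> path G (v a) (seg a.+1 l).
Proof. by move=> al; have := @seg_sorted a l.+1; rewrite /seg /=; apply; nlia. Qed.

Let seg_last a l : last (v a) (seg a.+1 l) = v (a + l).
Proof.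
by elim: l a => [|l IH] a; rewrite ?addn0 // /seg /= -/(seg a.+2 l) IH addSnnS.
Qed.

Let p_seg : p = seg 0 m.
Proof. by rewrite /seg map_nth_iota0 // take_size. Qed.

Let in_p x : x \in p -> exists2 k, (k < m)%N & x = v k.
Proof. by move=> xp; exists (index x p); rewrite ?index_mem // /v nth_index. Qed.

Let v_in k : (k < m)%N -> v k \in p. Proof. exact: mem_nth. Qed.

(** The chord and the segment between its ends form a cycle on [j - i + 1] vertices. *)
Let chord_short i j : (i < j)%N -> (j < m)%N -> G (v i) (v j) -> (j <= i.+2)%N.
Proof.
move=> ij jm g; rewrite leqNgt; apply/negP => h.
have := @no_long_cycle R n G simpleG qG (seg i (j - i).+1).
rewrite seg_uniq ?seg_size; last nlia.
have h3 : (3 < (j - i).+1)%N by nlia.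
have -> : cycle G (seg i (j - i).+1) = path G (v i) (rcons (seg i.+1 (j - i)) (v i)) by [].
move=> /(_ isT h3); rewrite rcons_path seg_path; last nlia.
by rewrite seg_last subnKC 1?ltnW // symG g.
Qed.

Let broom_free a K w w' : (0 < K)%N -> (a + K.+3 <= m)%N -> w != w' ->
  (forall k, (a <= k < a + K.+3)%N -> w != v k) ->
  (forall k, (a <= k < a + K.+3)%N -> w' != v k) ->
  G (v a.+1) w -> G (v (a + K.+1)) w' -> False.
Proof.
move=> K0 am ww' wv w'v g g'.
have us : uniq (seg a K.+3 ++ [:: w; w']).
  rewrite cat_uniq seg_uniq // andTb; apply/andP; split; last by rewrite /= inE ww'.
  apply/hasPn => x; rewrite !inE => /orP[]/eqP ->; [exact: (seg_notin wv)|exact: (seg_notin w'v)].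
have := no_double_broom (x0 := x0) simpleG qG K0 (seg_size _ _) (seg_sorted am) us.
have -> : nth x0 (seg a K.+3) 1 = v a.+1 by rewrite seg_nth // addn1.
have -> : nth x0 (seg a K.+3) K.+1 = v (a + K.+1) by rewrite seg_nth.
by rewrite g' => /(_ g).
Qed.

(** Overlapping chords give a 4-cycle, and chords with a common end a cricket. Otherwise the path
    from [v i.+1] to [v j.+1], with the outer ends [v i] and [v j.+2] as extra leaves, is a double
    broom. *)
Let two_chords i j : (i < j)%N -> (j.+2 < m)%N -> G (v i) (v i.+2) -> G (v j) (v j.+2) -> False.
Proof.
move=> ij jm gi gj.
have [e|n1] := eqVneq j i.+1.
  rewrite e in gj jm.
  have := @no_long_cycle R n G simpleG qG [:: v i; v i.+1; v i.+3; v i.+2].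
  rewrite /= !inE !vE ?gj; try nlia.
  rewrite v_edge; last nlia.
  rewrite (symG (v i.+3)) v_edge; last nlia.
  rewrite (symG (v i.+2)) gi /=; move=> h; suff : false by [].
  by apply: h => //; nlia.
have [e|n2] := eqVneq j i.+2.
  rewrite e in gj jm.
  have := @no_cricket R n G simpleG qG (v i.+2) (v i) (v i.+1) (v i.+3) (v i.+4).
  rewrite /= !inE !vE ?gj; try nlia.
  rewrite (symG (v i.+2) (v i)) gi (symG (v i.+2) (v i.+1)) !v_edge; nlia.
apply: (@broom_free i.+1 (j - i - 2) (v i) (v j.+2)); try nlia.
- by rewrite vE; nlia.
- by move=> k hk; rewrite vE; nlia.
- by move=> k hk; rewrite vE; nlia.
- by rewrite symG.
- by have -> : (i.+1 + (j - i - 2).+1 = j)%N by nlia.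
Qed.

Let longer s : uniq s -> sorted G s -> (m < size s)%N -> False.
Proof. by move=> us ss; have := max_p us ss; rewrite -/m; nlia. Qed.

Section Attach.
Variable w : 'I_n.
Hypothesis wp : w \notin p.

Let wv k : (k < m)%N -> w != v k.
Proof. by move=> km; apply: contraNneq wp => ->; exact: v_in. Qed.

Lemma attach_inner i : (i < m)%N -> G w (v i) -> (0 < i)%N && (i.+1 < m)%N.
Proof.
move=> im g; apply/andP; split.
  rewrite lt0n; apply/eqP => i0; apply: (@longer (w :: p)) => //=; first by rewrite wp.
  rewrite p_seg -(prednK (leq_ltn_trans (leq0n i) im)) /=.
  by rewrite -[v 0]/(v 0) -{1}i0 g seg_path //; nlia.
rewrite ltnNge; apply/negP => mi; apply: (@longer (rcons p w)).
- by rewrite rcons_uniq wp.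
- rewrite p_seg -(prednK (leq_ltn_trans (leq0n i) im)) /= rcons_path.
  rewrite seg_path; last nlia.
  have -> : last (v 0) (seg 1 m.-1) = v i by rewrite seg_last; congr v; nlia.
  by rewrite symG g.
- by rewrite size_rcons.
Qed.

(** Between two consecutive neighbours [w] could be inserted into the path; otherwise it closes a
    cycle of length at least 4. *)
Lemma attach_unique i j : (i < j)%N -> (j < m)%N -> G w (v i) -> G w (v j) -> False.
Proof.
move=> ij jm gi gj; have [e|ne] := eqVneq j i.+1.
  have wseg a l : (a + l <= m)%N -> w \notin seg a l.
    by move=> al; apply: seg_notin => k hk; apply: wv; nlia.
  apply: (@longer (seg 0 i.+1 ++ w :: seg i.+1 (m - i.+1))).
  - have d0 k : (i < k < m)%N -> v k \notin seg 0 i.+1.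
      by move=> hk; apply: (@seg_notin 0 i.+1) => t ht; rewrite vE; nlia.
    have w0 : w \notin seg 0 i.+1 by apply: wseg; nlia.
    have w1 : w \notin seg i.+1 (m - i.+1) by apply: wseg; nlia.
    have u0 : uniq (seg 0 i.+1) by apply: seg_uniq; nlia.
    have u1 : uniq (seg i.+1 (m - i.+1)) by apply: seg_uniq; nlia.
    rewrite cat_uniq (cons_uniq w) u0 u1 w1 !andbT andTb.
    apply/hasPn => x; rewrite inE => /orP[/eqP -> //|/mapP[k]].
    by rewrite mem_iota => hk ->; apply: d0; move: hk; clear; nlia.
  - rewrite [sorted _ _]/= -/(seg 1 i) cat_path seg_path ?seg_last; last nlia.
    have -> : (m - i.+1)%N = (m - i.+2).+1 by nlia.
    rewrite [path _ _ _]/= -/(seg i.+2 (m - i.+2)) (symG (v (0 + i))) gi -e gj e seg_path //.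
    by nlia.
  - by rewrite size_cat /= !seg_size; nlia.
have := @no_long_cycle R n G simpleG qG (w :: seg i (j - i).+1).
have w0 : w \notin seg i (j - i).+1 by apply: seg_notin => k hk; apply: wv; nlia.
have u0 : uniq (seg i (j - i).+1) by apply: seg_uniq; nlia.
have s0 : (3 < size (w :: seg i (j - i).+1))%N by rewrite [size _]/= seg_size; nlia.
rewrite (cons_uniq w) w0 u0 => /(_ isT s0).
have -> : cycle G (w :: seg i (j - i).+1) =
  G w (v i) && path G (v i) (rcons (seg i.+1 (j - i)) w) by [].
rewrite rcons_path gi seg_path ?seg_last; last nlia.
by rewrite subnKC 1?ltnW // symG gj.
Qed.

End Attach.

Section Pendant.
Variable w : 'I_n.
Hypothesis wp : w \notin p.

Let wv k : (k < m)%N -> w != v k.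
Proof. by move=> km; apply: contraNneq wp => ->; exact: v_in. Qed.

Let vw k : (k < m)%N -> v k != w. Proof. by rewrite eq_sym; exact: wv. Qed.

Variable i : nat.
Hypothesis im : (i < m)%N.
Hypothesis gwi : G w (v i).

Let i_gt0 : (0 < i)%N. Proof. by have /andP[] := attach_inner wp im gwi. Qed.
Let i_ltm : (i.+1 < m)%N. Proof. by have /andP[] := attach_inner wp im gwi. Qed.

Let giw : G (v i) w. Proof. by rewrite symG. Qed.
Let gi1 : G (v i) (v i.+1). Proof. exact: v_edge. Qed.
Let gi0 : G (v i) (v i.-1).
Proof. by rewrite symG; have := @v_edge i.-1; rewrite prednK //; apply. Qed.

(** The position of [i] decides. At an end of the chord there is a cricket; away from the triangle
    there is a double broom. At the middle vertex there is a net, unless the triangle sits at an end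
    of the path, where a detour through it reaches [w] by a longer path. *)
Lemma no_chord_with_pendant j : (j.+2 < m)%N -> G (v j) (v j.+2) -> False.
Proof.
move=> jm gj; have gj1 : G (v j) (v j.+1) by apply: v_edge; nlia.
have gj2 : G (v j.+1) (v j.+2) by apply: v_edge; nlia.
have [e|n1] := eqVneq i j.
  have := @no_cricket R n G simpleG qG (v i) (v i.+1) (v i.+2) (v i.-1) w.
  rewrite /= !inE !(negbTE (vw _)) ?vE; try nlia.
  have gi2 : G (v i) (v i.+2) by rewrite e.
  have gi12 : G (v i.+1) (v i.+2) by rewrite e.
  rewrite gi1 gi2 gi0 giw gi12 => h; suff : false by [].
  by apply: h => //; nlia.
have [e|n2] := eqVneq i j.+2.
  have := @no_cricket R n G simpleG qG (v i) (v j) (v j.+1) (v i.+1) w.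
  rewrite /= !inE !(negbTE (vw _)) ?vE; try nlia.
  have gij : G (v i) (v j) by rewrite e symG.
  have gij1 : G (v i) (v j.+1) by rewrite e symG.
  rewrite gij gij1 gi1 giw gj1 => h; suff : false by [].
  by apply: h => //; nlia.
have [e|n3] := eqVneq i j.+1.
  have [j0|j0] := posnP j.
    subst j; apply: (@longer (w :: v 1 :: v 0 :: seg 2 (m - 2))).
    - rewrite !cons_uniq seg_uniq; last nlia.
      rewrite !inE !negb_or !wv ?vE ?seg_notin //=; try nlia.
      + by move=> k hk; rewrite vE; nlia.
      + by move=> k hk; rewrite vE; nlia.
      + by move=> k hk; apply: wv; nlia.
    - have -> : (m - 2)%N = (m - 3).+1 by nlia.
      rewrite [sorted _ _]/= -/(seg 3 (m - 3)) -{1}e gwi (symG (v 1)) gj1 gj.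
      by apply: seg_path; nlia.
    - by rewrite /= seg_size; nlia.
  have [jl|jl] := eqVneq j.+3 m.
    apply: (@longer (seg 0 j.+1 ++ [:: v j.+2; v j.+1; w])).
    - have u0 : uniq (seg 0 j.+1) by apply: seg_uniq; nlia.
      have u1 : uniq [:: v j.+2; v j.+1; w].
        by rewrite /= !inE !(negbTE (vw _)) ?vE; nlia.
      rewrite cat_uniq u0 u1 andbT; apply/hasPn => x.
      rewrite !inE => /or3P[]/eqP ->; apply: (@seg_notin 0 j.+1) => k hk.
      + by rewrite vE; nlia.
      + by rewrite vE; nlia.
      + by apply: wv; nlia.
    - rewrite [sorted _ _]/= -/(seg 1 j) cat_path seg_path ?seg_last ?add0n /=; last nlia.
      by rewrite gj (symG (v j.+2)) gj2 -e giw.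
    - by rewrite size_cat /= seg_size; nlia.
  have := @no_net R n G simpleG qG (v j) (v j.+1) (v j.+2) (v j.-1) w (v j.+3).
  rewrite /= !inE !(negbTE (vw _)) ?(negbTE (wv _)) ?vE; try nlia.
  have gjw : G (v j.+1) w by rewrite -e.
  have gj3 : G (v j.+2) (v j.+3) by apply: v_edge; nlia.
  have gj0 : G (v j) (v j.-1).
    by rewrite symG; have := @v_edge j.-1; rewrite prednK //; apply; nlia.
  rewrite gj1 gj2 gj gjw gj3 gj0 => h; suff : false by [].
  by apply: h => //; nlia.
have [ij|ji] := ltnP i j.
  apply: (@broom_free i.-1 (j - i) w (v j.+2)); try nlia.
  - by apply: wv; nlia.
  - by move=> k hk; apply: wv; nlia.
  - by move=> k hk; rewrite vE; nlia.
  - by rewrite prednK.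
  - by have -> : (i.-1 + (j - i).+1 = j)%N by nlia.
apply: (@broom_free j.+1 (i - j - 2) (v j) w); try nlia.
- by apply: vw; nlia.
- by move=> k hk; rewrite vE; nlia.
- by move=> k hk; apply: wv; nlia.
- by rewrite symG.
- by have -> : (j.+1 + (i - j - 2).+1 = i)%N by nlia.
Qed.

(** A common attachment vertex would have degree four; distinct ones span a double broom. *)
Lemma no_second_attachment w' j : w' \notin p -> w' != w -> (j < m)%N -> G w' (v j) -> False.
Proof.
move=> w'p w'w jm g'; have w'v k : (k < m)%N -> w' != v k.
  by move=> km; apply: contraNneq w'p => ->; exact: v_in.
have g : G (v j) w' by rewrite symG.
have /andP[j0 j1] := attach_inner w'p jm g'.
have [e|ne] := eqVneq i j.
  have us : uniq [:: v i.-1; v i.+1; w; w'].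
    rewrite /= !inE !(negbTE (vw _)) ?vE; try nlia.
    by rewrite ![v _ == w']eq_sym !(negbTE (w'v _ _)) ?[w == _]eq_sym ?(negbTE w'w); nlia.
  by have := no_degree_four simpleG qG us gi0 gi1 giw; rewrite e g.
have [ij|ji] := ltnP i j.
  apply: (@broom_free i.-1 (j - i) w w'); try nlia.
  - by rewrite eq_sym.
  - by move=> k hk; apply: wv; nlia.
  - by move=> k hk; apply: w'v; nlia.
  - by rewrite prednK.
  - by have -> : (i.-1 + (j - i).+1 = j)%N by nlia.
apply: (@broom_free j.-1 (i - j) w' w); try nlia.
- by move=> k hk; apply: w'v; nlia.
- by move=> k hk; apply: wv; nlia.
- by rewrite prednK.
- by have -> : (j.-1 + (i - j).+1 = i)%N by nlia.
Qed.

(** If [v i] has two path vertices on each side, there is a spider with centre [v i]. Otherwise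
    replacing the short side by [w], [w'] gives a longer path. *)
Lemma no_longer_pendant w' : w' \notin p -> w' != w -> ~~ G w w'.
Proof.
move=> w'p w'w; apply/negP => gww'.
have w'v k : (k < m)%N -> w' != v k.
  by move=> km; apply: contraNneq w'p => ->; exact: v_in.
have i2 : (1 < i)%N.
  rewrite ltnNge; apply/negP => i1.
  apply: (@longer (w' :: w :: seg i (m - i))).
  - have w0 : w \notin seg i (m - i) by apply: seg_notin => k hk; apply: wv; nlia.
    have w1 : w' \notin seg i (m - i) by apply: seg_notin => k hk; apply: w'v; nlia.
    have u0 : uniq (seg i (m - i)) by apply: seg_uniq; nlia.
    by rewrite (cons_uniq w') (cons_uniq w) inE negb_or w'w w0 w1 u0.
  - have -> : (m - i = (m - i.+1).+1)%N by nlia.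
    have -> : sorted G (w' :: w :: seg i (m - i.+1).+1) =
      [&& G w' w, G w (v i) & path G (v i) (seg i.+1 (m - i.+1))] by [].
    by rewrite symG gww' gwi seg_path //; nlia.
  - by rewrite /= seg_size; nlia.
have im2 : (i.+2 < m)%N.
  rewrite ltnNge; apply/negP => i1.
  apply: (@longer (seg 0 i.+1 ++ [:: w; w'])).
  - have w0 : w \notin seg 0 i.+1 by apply: seg_notin => k hk; apply: wv; nlia.
    have w1 : w' \notin seg 0 i.+1 by apply: seg_notin => k hk; apply: w'v; nlia.
    have u0 : uniq (seg 0 i.+1) by apply: seg_uniq; nlia.
    rewrite cat_uniq u0 andTb; apply/andP; split; last by rewrite /= inE (eq_sym w) w'w.
    by apply/hasPn => x; rewrite !inE => /orP[]/eqP ->.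
  - rewrite [sorted _ _]/= -/(seg 1 i) cat_path seg_path ?seg_last ?add0n /=; last nlia.
    by rewrite giw gww'.
  - by rewrite size_cat /= seg_size; nlia.
have us : uniq [:: v i; v i.-1; v i.+1; w; v i.-2; v i.+2; w'].
  rewrite /= !inE !(negbTE (vw _)) ?(negbTE (wv _)) ?vE; try nlia.
  by rewrite ![v _ == w']eq_sym !(negbTE (w'v _ _)) ?[w == _]eq_sym ?(negbTE w'w); nlia.
have h1 : G (v i.-1) (v i.-2).
  by rewrite symG; have := @v_edge i.-2; have -> : (i.-2.+1 = i.-1)%N by [nlia]; apply; nlia.
have h2 : G (v i.+1) (v i.+2) by exact: v_edge.
by have := no_spider simpleG qG us gi0 gi1 giw h1 h2; rewrite gww'.
Qed.
End Pendant.

Let crossing (a : pred 'I_n) x y : a x -> ~~ a y -> exists u t, [/\ a u, ~~ a t & G u t].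
Proof.
move=> ax ay; have [/existsP[u /existsP[t /and3P[? ? ?]]]|no] :=
  boolP [exists u, exists t, [&& a u, ~~ a t & G u t]]; first by exists u, t.
have clo : closed_mem G (mem a).
  apply: intro_closed; first exact: sym_connect_sym.
  move=> u t g au; apply/negPn/negP => nat; move/negP: no; apply.
  by apply/existsP; exists u; apply/existsP; exists t; rewrite g andbT; apply/andP.
by have := closed_connect clo (connG x y); rewrite !unfold_in ax (negbTE ay).
Qed.

Lemma longest_path_GSSP : (0 < m)%N -> in_GSSP R G.
Proof.
move=> m0 A SGA X sX AX0 X0 AXC.
have chordless r s : (r < m)%N -> (s < m)%N -> G (v r) (v s) ->
    [|| s == r.+1, r == s.+1, (r.+2 == s) | (s.+2 == r)].
  move=> rm sm g; have [rs|sr|e] := ltngtP r s.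
  - by have := chord_short rs sm g; nlia.
  - by rewrite symG in g; have := chord_short sr rm g; nlia.
  - by move: g; rewrite e irrG.
have vedge r s : (r < m)%N -> (s < m)%N -> (s == r.+1) || (r == s.+1) -> G (v r) (v s).
  move=> rm sm /orP[]/eqP e; first by rewrite e v_edge // -e.
  by rewrite e symG v_edge // -e.
have [/forallP allp|/forallPn[z zp]] := boolP [forall z, z \in p].
  have span z : exists2 k, (k < m)%N & z = v k by apply: in_p; exact: allp.
  have [/existsP[i /andP[im gi]]|no] := boolP [exists i : 'I_m, (i.+2 < m)%N && G (v i) (v i.+2)].
    apply: (chord_SSP simpleG SGA sX AX0 X0 AXC v_inj span im) => r s rm sm.
    apply/idP/idP => [g|].
      have short a b : (a < m)%N -> (b < m)%N -> (a.+2 == b) -> G (v a) (v b) -> a = i.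
        move=> am bm /eqP ab gab; rewrite -ab in gab bm.
        have [ai|ia|//] := ltngtP a i; first by case: (two_chords ai im gab gi).
        by case: (two_chords ia bm gi gab).
      have := chordless r s rm sm g => /or4P[-> //|->|rs|sr]; rewrite ?orbT //.
        by have := short r s rm sm rs g; nlia.
      by rewrite symG in g; have := short s r sm rm sr g; nlia.
    move=> /or4P[h|h|/andP[/eqP -> /eqP ->] //|/andP[/eqP -> /eqP ->]].
    - by apply: vedge => //; rewrite h.
    - by apply: vedge => //; rewrite h orbT.
    - by rewrite symG.
  apply: (path_SSP simpleG SGA sX AX0 X0 AXC v_inj span) => r s rm sm.
  apply/idP/idP => [g|]; last exact: vedge.
  have noc a b : (a < m)%N -> (b < m)%N -> (a.+2 == b) -> ~~ G (v a) (v b).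
    move=> am bm /eqP ab; apply/negP => gab; rewrite -ab in bm gab.
    move/negP: no; apply; apply/existsP; exists (Ordinal am) => /=.
    by rewrite bm.
  have := chordless r s rm sm g => /or4P[-> //|->|rs|sr]; rewrite ?orbT //.
    by move: (noc r s rm sm rs); rewrite g.
  by move: (noc s r sm rm sr); rewrite symG g.
have [u [w [/in_p[i im ->] wp giw]]] := @crossing (mem p) (v 0) z (v_in m0) zp.
have gwi : G w (v i) by rewrite symG.
have /andP[i0 i1] := attach_inner wp im gwi.
have span y : y = w \/ exists2 k, (k < m)%N & y = v k.
  have [yp|yp] := boolP (y \in p); first by right; exact: in_p.
  have [->|yw] := eqVneq y w; first by left.
  (* A further vertex would yield an edge leaving the set of [p] and [w]: from [p] it would be a
     second attachment, from [w] it would lengthen the pendant branch. *)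
  have [||a [b [+ nb gab]]] := @crossing [pred x | (x \in p) || (x == w)] (v 0) y.
  - by rewrite /= v_in.
  - by rewrite /= (negbTE yp).
  move: nb; rewrite /= negb_or => /andP[bp bw] /orP[/in_p[j jm aj]|/eqP aw].
    exfalso; apply: (no_second_attachment wp im gwi bp bw jm).
    by rewrite symG -aj.
  by move: gab; rewrite aw (negbTE (no_longer_pendant wp im gwi bp bw)).
have wv k : (k < m)%N -> w != v k.
  by move=> km; apply: contraNneq wp => ->; exact: v_in.
apply: (pendant_SSP simpleG SGA sX AX0 X0 AXC v_inj i0 i1 span wv) => [r s rm sm|s sm].
  apply/idP/idP => [g|]; last exact: vedge.
  have noc a b : (a < m)%N -> (b < m)%N -> (a.+2 == b) -> G (v a) (v b) -> False.
    move=> am bm /eqP ab gab; rewrite -ab in bm gab.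
    exact: (no_chord_with_pendant wp im gwi bm gab).
  have := chordless r s rm sm g => /or4P[-> //|->|rs|sr]; rewrite ?orbT //.
    by case: (noc r s rm sm rs g).
  by rewrite symG in g; case: (noc s r sm rm sr g).
apply/idP/eqP => [g|->//].
have [si|i_s|//] := ltngtP s i; first by case: (attach_unique wp si im g gwi).
by case: (attach_unique wp i_s sm gwi g).
Qed.
End LongestPath.

Theorem theorem5p6 (R : realType) (n : nat) (G : rel 'I_n) :
  simple_graph G -> connected_graph G ->
  q_graph_ge R G n.-1 ->
  in_GSSP R G.
Proof.
move=> simpleG connG qG.
have [n0|n0] := posnP n.
  by subst n => A _ X _ _ _ _; apply/matrixP => -[].
pose x0 : 'I_n := Ordinal n0.
pose P k := [exists s : k.-tuple 'I_n, uniq s && sorted G s].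
have P1 : P 1%N by apply/existsP; exists [tuple x0].
have Pn k : P k -> (k <= n)%N.
  move=> /existsP[s /andP[us _]].
  by have := max_card (mem s); rewrite (card_uniqP us) size_tuple card_ord.
have [k /existsP[s /andP[us ss]] kmax] := ex_maxnP (ex_intro _ 1%N P1) Pn.
have k0 : (0 < k)%N by exact: kmax.
apply: (@longest_path_GSSP R n G simpleG connG qG x0 s us ss); last by rewrite size_tuple.
move=> t ut st; rewrite size_tuple; apply: kmax.
by apply/existsP; exists (in_tuple t); rewrite ut st.
Qed.
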